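(* Let $X$ be a geodesic metric space with a bounded quasi-geodesic combing (that is, a bounded $(\lambda_0,\kappa_0)$-quasi-geodesic combing for some $\lambda_0\ge1$, $\kappa_0\ge0$). Then $X$ satisfies the weak Morse local-to-global property.
   Context: A $(\lambda,\kappa)$-quasi-geodesic ($\lambda\ge1,\kappa\ge0$) is a map $\gamma:I\to X$, $I\subseteq\mathbb R$ a closed interval, with $\frac1\lambda|s-t|-\kappa\le d(\gamma(s),\gamma(t))\le\lambda|s-t|+\kappa$ for all $s,t\in I$. Convention: all quasi-geodesics are assumed improved, i.e. continuous and such that the arc length of $\gamma|_{[t,t']}$ is at most $k_1 d(\gamma(t),\gamma(t'))+k_2$ for all $t,t'$, where $k_1=\lambda(\lambda+\kappa)$, $k_2=(\lambda\kappa'+3)(\lambda+\kappa)$, $\kappa'=2(\lambda+\kappa)$ (in a geodesic space every quasi-geodesic is approximated by such a one). A path is a continuous map from an interval to $X$. $\mathcal N_r(Y)$ is the closed $r$-neighbourhood of $Y$. Bounded combing: a $(\lambda_0,\kappa_0)$-quasi-geodesic combing assigns to every ordered pair $(x,y)\in X\times X$ a $(\lambda_0,\kappa_0)$-quasi-geodesic $\mathfrak q_{xy}:[0,T_{xy}]\to X$ from $x$ to $y$ (extended to $\mathbb R$ by constant maps). It is bounded if $d(\mathfrak q_{xy_1}(t),\mathfrak q_{xy_2}(t))\le\kappa_0 d(y_1,y_2)+\kappa_0$ for all $t\in\mathbb R$ and $x,y_1,y_2\in X$. A Morse gauge is a function $M:\mathbb R_{\ge1}\times\mathbb R_{\ge0}\to\mathbb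 R_{\ge0}$. A quasi-geodesic $\gamma$ is $M$-Morse if every $(Q,q)$-quasi-geodesic $\eta$ with endpoints $\gamma(s),\gamma(t)$ satisfies $\eta\subseteq\mathcal N_{M(Q,q)}(\gamma|_{[s,t]})$. For a fixed pair $(Q,q)$ and $\mu\ge0$, $\gamma$ is $(Q,q,\mu)$-weakly Morse if every $(Q,q)$-quasi-geodesic $\eta$ with endpoints $\gamma(s),\gamma(t)$ satisfies $\eta\subseteq\mathcal N_\mu(\gamma|_{[s,t]})$. A path $\mathfrak p$ is $L$-locally (P) if every restriction $\mathfrak p|_{[t_1,t_2]}$ with $|t_1-t_2|\le L$ has property (P). Weak Morse local-to-global (weak MLTG) property: for all quasi-geodesic pairs $(\lambda,\kappa)$ and $(Q,q)$ and every Morse gauge $M$ there exist a scale $L$, a quasi-geodesic pair $(\lambda',\kappa')$ and a constant $\mu\ge0$ such that every path that is $L$-locally an $M$-Morse $(\lambda,\kappa)$-quasi-geodesic is globally a $(\lambda',\kappa')$-quasi-geodesic that is $(Q,q,\mu)$-weakly Morse. *)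

(* Defs.v *)
From HB Require Import structures.
From mathcomp Require Import all_boot all_order all_algebra.
From mathcomp Require Import all_classical all_reals all_analysis.

Set Implicit Arguments.
Unset Strict Implicit.
Unset Printing Implicit Defensive.

Import Order.TTheory GRing.Theory Num.Theory.
Import numFieldNormedType.Exports.

Local Open Scope classical_set_scope.
Local Open Scope ring_scope.

(* A map g : I -> X from I `<=` R is a total function g : R -> X together with
   the set I; every predicate below depends only on the values of g on I, so
   the restriction of g to J `<=` I is the same function taken with J. *)
Section quasi_geodesics.
Context {R : realType} {X : metricType R}.
Implicit Types (g eta p : R -> X) (I : set R) (Y : set X).

(* Bounded, half-infinite or all of R; [a, a] is allowed. *)
Definition closed_interval I : Prop := is_interval I /\ closed I.

Definition qg_pair (lam kap : R) : Prop := 1 <= lam /\ 0 <= kap.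

(* The analogue of [variation] and [total_variation], with mdist in place of
   the absolute value. *)
Definition polygonal_length g (a b : R) (s : seq R) : R :=
  \sum_(0 <= n < size s)
    mdist (g (nth b (a :: s) n)) (g (nth b (a :: s) n.+1)).

Definition arc_length g (a b : R) : \bar R :=
  ereal_sup [set (polygonal_length g a b s)%:E | s in itv_partition a b].

Definition improve_k1 (lam kap : R) : R := lam * (lam + kap).

Definition improve_k2 (lam kap : R) : R :=
  let kap' := 2 * (lam + kap) in (lam * kap' + 3) * (lam + kap).

(* The last two clauses are the standing convention that quasi-geodesics are
   improved. *)
Definition quasi_geodesic (lam kap : R) I g : Prop :=
  [/\ closed_interval I,
      forall s t, I s -> I t ->
        lam^-1 * `|s - t| - kap <= mdist (g s) (g t) <= lam * `|s - t| + kap,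
      {within I, continuous g} &
      forall t t', I t -> I t' -> t <= t' ->
        (arc_length g t t' <=
          (improve_k1 lam kap * mdist (g t) (g t') + improve_k2 lam kap)%:E)%E].

(* The infimum is taken in \bar R, hence is +oo when Y is empty. *)
Definition closed_nbhd (r : R) Y : set X :=
  [set x | (ereal_inf [set (mdist x y)%:E | y in Y] <= r%:E)%E].

Definition weakly_morse (Q q mu : R) I g : Prop :=
  forall s t, I s -> I t -> s <= t ->
  forall (a b : R) eta, a <= b -> quasi_geodesic Q q `[a, b] eta ->
    eta a = g s -> eta b = g t ->
    eta @` `[a, b] `<=` closed_nbhd mu (g @` `[s, t]).

(* Only the values on pairs with 1 <= Q and 0 <= q matter. *)
Definition morse_gauge (M : R -> R -> R) : Prop :=
  forall Q q, qg_pair Q q -> 0 <= M Q q.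

Definition morse (M : R -> R -> R) I g : Prop :=
  forall Q q, qg_pair Q q -> weakly_morse Q q (M Q q) I g.

Definition path_on I p : Prop :=
  closed_interval I /\ {within I, continuous p}.

Definition locally_on (L : R) (P : set R -> (R -> X) -> Prop) I p : Prop :=
  forall t1 t2, I t1 -> I t2 -> t1 <= t2 -> `|t1 - t2| <= L -> P `[t1, t2]%classic p.

End quasi_geodesics.

Section spaces.
Context {R : realType} (X : metricType R).

Definition geodesic_space : Prop :=
  forall x y : X, exists g : R -> X,
    [/\ g 0 = x, g (mdist x y) = y &
        forall s t, s \in `[0, mdist x y] -> t \in `[0, mdist x y] ->
          mdist (g s) (g t) = `|s - t|].

(* T x y is the length of the domain of the combing line from x to y, which
   is extended to R by constant maps. *)
Definition qg_combing (lam0 kap0 : R) (T : X -> X -> R)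
    (c : X -> X -> R -> X) : Prop :=
  forall x y,
    [/\ 0 <= T x y, quasi_geodesic lam0 kap0 `[0, T x y] (c x y),
        forall t, t <= 0 -> c x y t = x &
        forall t, T x y <= t -> c x y t = y].

Definition bounded_combing (kap0 : R) (c : X -> X -> R -> X) : Prop :=
  forall (t : R) (x y1 y2 : X),
    mdist (c x y1 t) (c x y2 t) <= kap0 * mdist y1 y2 + kap0.

Definition has_bounded_qg_combing : Prop :=
  exists lam0 kap0 : R, qg_pair lam0 kap0 /\
  exists (T : X -> X -> R) (c : X -> X -> R -> X),
    qg_combing lam0 kap0 T c /\ bounded_combing kap0 c.

Definition weak_MLTG : Prop :=
  forall (lam kap Q q : R) (M : R -> R -> R),
    qg_pair lam kap -> qg_pair Q q -> morse_gauge M ->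
  exists L lam' kap' mu : R,
    [/\ 0 < L, qg_pair lam' kap', 0 <= mu &
        forall (I : set R) (p : R -> X), path_on I p ->
          locally_on L
            (fun J g => quasi_geodesic lam kap J g /\ morse M J g) I p ->
          quasi_geodesic lam' kap' I p /\ weakly_morse Q q mu I p].

End spaces.

(* Main.v *)
(* Let p be a long local Morse path.  By induction on the length of the
   subpath one shows that a quasi-geodesic eta with endpoints on p passes within
   a uniform distance of every point z between them.  For w on eta follow the
   combing line from z to w and record how long it stays close to p: at one end
   of eta it leaves p immediately, at the other end it follows p all the way.
   If w moves to w' far from p while this departure point advances by N, then
   |w w'| > K N for any prescribed K, provided N is large.  Indeed, otherwise
   boundedness of the combing joins the two lines, deep beyond their departure
   points, by a segment of length O(K N), and one extracts from this a
   quasi-geodesic with constants independent of N, with endpoints on p and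
   leaving every bounded neighbourhood of p as N grows; this contradicts the
   Morse property of a piece of p of length N.  Since the length of eta away
   from p is linear in the progress along p, choosing K larger than the
   constants of eta forces eta to come close to p on both sides of z, close to
   z.  The Morse property at scale L then improves the constants to ones that
   do not depend on the stage of the induction.  All combing lines compared with
   each other start at the same point z, so boundedness in the end point
   suffices. *)

Require Import Defs.
From HB Require Import structures.
From mathcomp Require Import all_boot all_order all_algebra.
From mathcomp Require Import all_classical all_reals all_analysis.
From mathcomp Require Import zify ring lra.

Set Implicit Arguments.
Unset Strict Implicit.
Unset Printing Implicit Defensive.

(** The factor [8 * Q * A] lets the sum of the two estimates beat the third: the left side is
    [8 * Q * A * d], while [4 * k] contributes only [4 * Q * A * d]. *)
Lemma drift_bound A Q B E k d d1 d2 : 0 < A -> 0 < Q -> d1 + d2 = d ->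
  8 * Q * A * d1 <= 2 * k + 8 * Q * A * E ->
  8 * Q * A * d2 <= 2 * k + 8 * Q * A * E ->
  k <= Q * (2 * B + A * d) + Q -> d <= 2 * B + 1 + 4 * E.
Proof.
move=> A0 Q0 <-; rewrite -!(mulnA 8) mulnDr [Q * (A * _)]mulnA.
have : Q <= Q * A by rewrite leq_pmulr.
have : Q * (2 * B) <= Q * A * (2 * B) by rewrite leq_mul2r leq_pmulr ?orbT.
have : 0 < Q * A by rewrite muln_gt0 Q0.
move: (Q * A) => q q0 qB Qq h1 h2 h3.
by rewrite -(leq_pmul2l q0); lia.
Qed.

(** * Discrete quasi-geodesics *)

Section DiscreteQuasiGeodesics.
Context {X : Type} (D : X -> X -> nat).
Context (Dxx : forall x, D x x = 0) (DC : forall x y, D x y = D y x)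
  (Dtri : forall y x z, D x z <= D x y + D y z).
Context (Dgeo : forall x y, exists g : nat -> X, [/\ g 0 = x, g (D x y) = y &
  forall i j, i <= j -> j <= D x y -> D (g i) (g j) = j - i]).
Implicit Types (x v : X) (y P : nat -> X).

Definition dqg C k y :=
  (forall i, i < k -> D (y i) (y i.+1) <= C) /\
  (forall i j, i <= j -> j <= k -> j <= i + (C * D (y i) (y j) + C)).

Lemma dqg_step C k y i j : dqg C k y -> i <= j -> j <= k ->
  D (y i) (y j) <= C * (j - i).
Proof.
move=> [yS _]; elim: j => [|j IH]; first by rewrite leqn0 => /eqP->; rewrite Dxx.
rewrite leq_eqVlt => /orP[/eqP->|ij jk]; first by rewrite Dxx.
have := IH ij (ltnW jk); have := yS _ jk; have := Dtri (y j) (y i) (y j.+1).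
rewrite subSn // mulnS; lia.
Qed.

Lemma dqgW C C' k y : C <= C' -> dqg C k y -> dqg C' k y.
Proof.
move=> CC [yS yL]; split=> [i /yS|i j ij jk]; first lia.
have := yL _ _ ij jk.
have : C * D (y i) (y j) <= C' * D (y i) (y j) by rewrite leq_mul2r CC orbT.
lia.
Qed.

Lemma dqg_sub C k y s k' : dqg C k y -> s + k' <= k ->
  dqg C k' (fun l => y (s + l)).
Proof.
move=> [yS yL] sk; split=> [i ik|i j ij jk].
  by rewrite addnS; apply: yS; lia.
by have := yL (s + i) (s + j); lia.
Qed.

Lemma dqg_rev C k y : dqg C k y -> dqg C k (fun l => y (k - l)).
Proof.
move=> [yS yL]; split=> [i ik|i j ij jk].
  by rewrite DC; have := yS (k - i.+1); rewrite -subSn // subSS; apply; lia.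
by rewrite DC; have := yL (k - j) (k - i); lia.
Qed.

(** The second piece starts at index [n.+1], so the passage from [y n] to [y' 0] is itself a
    step. *)
Definition catp n y y' l := if l <= n then y l else y' (l - n.+1).

Lemma catpL n y y' l : l <= n -> catp n y y' l = y l.
Proof. by rewrite /catp => ->. Qed.

Lemma catpR n y y' l : catp n y y' (n + l).+1 = y' l.
Proof. by rewrite /catp ifN ?subSS ?addKn // -ltnNge ltnS leq_addr. Qed.

Lemma dqg_glue C C' n m y y' : C <= C' -> dqg C n y -> dqg C m y' ->
  D (y n) (y' 0) <= C' ->
  (forall i j, i <= n -> j <= m ->
     n + j + 1 <= i + (C' * D (y i) (y' j) + C')) ->
  dqg C' (n + m).+1 (catp n y y').
Proof.
move=> CC /(dqgW CC)[yS yL] /(dqgW CC)[yS' yL'] mid far; rewrite /catp; split.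
  move=> i ik; case: (leqP i n) => iN; case: (leqP i.+1 n) => iN'.
  - exact: yS.
  - by rewrite (_ : i = n) ?subnn //; lia.
  - lia.
  - by rewrite (_ : i.+1 - n.+1 = (i - n.+1).+1); [apply: yS'; lia|lia].
move=> i j ij jk; case: (leqP j n) => jn; case: (leqP i n) => iN.
- exact: yL.
- lia.
- have := far i (j - n.+1) iN; lia.
- have := yL' (i - n.+1) (j - n.+1); lia.
Qed.

Lemma argmin (f : nat -> nat) n :
  exists2 i, i <= n & forall j, j <= n -> f i <= f j.
Proof.
elim: n => [|n [i ile imin]].
  by exists 0 => // j; rewrite leqn0 => /eqP->.
have [lt|le] := leqP (f i) (f n.+1).
  exists i => [|j]; first lia.
  by rewrite leq_eqVlt => /orP[/eqP->//|]; apply: imin.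
exists n.+1 => // j; rewrite leq_eqVlt => /orP[/eqP->//|jn].
by apply: leq_trans (ltnW le) _; apply: imin.
Qed.

Lemma argmin2 (f : nat -> nat -> nat) n m :
  exists i j, [/\ i <= n, j <= m &
    forall i' j', i' <= n -> j' <= m -> f i j <= f i' j'].
Proof.
elim: n => [|n [i [j [iN jm ijmin]]]].
  have [j jm jmin] := argmin (f 0) m; exists 0, j; split=> // i' j'.
  by rewrite leqn0 => /eqP->; apply: jmin.
have [j1 jm1 jmin] := argmin (f n.+1) m.
have [le|lt] := leqP (f i j) (f n.+1 j1).
  exists i, j; split=> // [|i' j']; first lia.
  rewrite leq_eqVlt => /orP[/eqP->/jmin|]; [exact: leq_trans|exact: ijmin].
exists n.+1, j1; split=> // i' j'.
rewrite leq_eqVlt => /orP[/eqP->/jmin//|i'n j'm].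
by apply: leq_trans (ltnW lt) _; apply: ijmin.
Qed.

(** Since [y s] is closest to [v], the point at distance [j] from [y s] on the geodesic to [v] is at
    least [j] away from every earlier [y i]. So [D (y i) (y s)] is at most twice the distance from
    [y i] to that point, and the corner causes no backtracking. *)
Lemma concat_closest C k y v : 0 < C -> dqg C k y ->
  exists k' y' s, [/\ dqg (3 * C) k' y', y' 0 = y 0, y' k' = v, s <= k &
   [/\ forall i, i <= k -> D (y s) v <= D (y i) v,
       k' = (s + D (y s) v).+1,
       forall l, l <= s -> y' l = y l &
       forall l, s <= l -> l <= k' -> D (y' l) v <= D (y s) v]].
Proof.
move=> C0 yQ; have [s sk smin] := argmin (fun i => D (y i) v) k.
have [g [g0 gD gE]] := Dgeo (y s) v.
have gS i : i <= D (y s) v -> D (g i) v = D (y s) v - i.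
  by move=> id; rewrite -{1}gD; apply: gE.
exists (s + D (y s) v).+1, (catp s y g), s; split=> //; last split=> //.
- apply: (@dqg_glue C); rewrite ?g0 ?Dxx //; first lia.
  - by have := @dqg_sub C k y 0 s yQ sk.
  - by split=> [i id|i j ij jd]; rewrite gE //; nia.
  - move=> i j iS jd.
    have h1 := smin i (leq_trans iS sk); have h2 := gS _ jd.
    have h3 := Dtri (g j) (y i) v.
    have h4 : D (g j) (y s) = j by rewrite DC -g0 gE // subn0.
    have h5 := Dtri (g j) (y i) (y s).
    have h6 := yQ.2 _ _ iS sk.
    have h7 : C * D (y i) (y s) <= C * (D (y i) (g j) + D (y i) (g j)).
      by apply: leq_mul => //; lia.
    nia.
- by rewrite catpR.
- by move=> l; rewrite /catp => ->.
- move=> l sl lk; rewrite /catp; case: (leqP l s) => ls.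
    by rewrite (_ : l = s) //; lia.
  by rewrite gS; lia.
Qed.

(* Weighting the two lengths against E times the jump keeps both corners of
   the concatenation away from backtracking. *)
Lemma concat_optimal C E n m y y' : 0 < C -> 0 < E -> dqg C n y -> dqg C m y' ->
  exists i j k p, [/\ i <= n, j <= m, dqg (C + E + 2) k p,
    p 0 = y 0 /\ p k = y' 0 &
    [/\ forall i' j', i' <= n -> j' <= m ->
          E * D (y i) (y' j) + (i + j) <= E * D (y i') (y' j') + (i' + j'),
        forall l, l <= i -> exists2 l', l' <= k & p l' = y l &
        forall l, l <= j -> exists2 l', l' <= k & p l' = y' l]].
Proof.
move=> C0 E0 yQ yQ'.
have [i [j [iN jm ijmin]]] := argmin2 (fun i j => E * D (y i) (y' j) + (i + j)) n m.
have [g [g0 gD gE]] := Dgeo (y i) (y' j).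
set d := D (y i) (y' j) in gD gE ijmin.
have gS l : l <= d -> D (g l) (y' j) = d - l.
  by move=> id; rewrite -{1}gD; apply: gE.
have gS' l : l <= d -> D (y i) (g l) = l.
  by move=> id; rewrite -g0 gE // subn0.
have q1 : dqg (C + E + 2) (i + d).+1 (catp i y g).
  apply: (@dqg_glue C); rewrite ?g0 ?Dxx //; first lia.
  - by have := @dqg_sub C n y 0 i yQ iN.
  - by split=> [l ld|l l' ll ld]; rewrite gE //; nia.
  - move=> i' l i'i ld; have h1 := ijmin i' j (leq_trans i'i iN) jm.
    have h2 := gS _ ld; have h3 := Dtri (g l) (y i') (y' j).
    have h4 : E * D (y i') (y' j) <= E * (D (y i') (g l) + (d - l)).
      by apply: leq_mul => //; lia.
    have h5 : E * d = E * l + E * (d - l) by rewrite -mulnDr subnKC.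
    have h6 : l <= E * l by apply: leq_pmull.
    nia.
have q2 : dqg (C + E + 2) j (fun l => y' (j - l)).
  by apply: (@dqgW C); [lia|apply/dqg_rev/(@dqg_sub C m y' 0 j)].
exists i, j, ((i + d).+1 + j).+1, (catp (i + d).+1 (catp i y g) (fun l => y' (j - l))).
split=> //; [|split|split=> //].
- apply: (@dqg_glue (C + E + 2)) => //.
    by rewrite catpR subn0 gD Dxx.
  move=> a b; rewrite /catp => ad bj; case: (leqP a i) => ai.
    have := ijmin a (j - b) (leq_trans ai iN); move: (leq_pmull d E0).
    by move: (D (y a) _) => x; nia.
  have h1 := ijmin i (j - b) iN; set l := a - i.+1; have ld : l <= d by lia.
  have h3 := Dtri (g l) (y i) (y' (j - b)).
  have h2 := gS' _ ld.
  have h4 : E * D (y i) (y' (j - b)) <= E * (l + D (g l) (y' (j - b))).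
    by apply: leq_mul => //; lia.
  have h5 : E * d = E * l + E * (d - l) by rewrite -mulnDr subnKC.
  have h6 : d - l <= E * (d - l) by apply: leq_pmull.
  have h7 : a = i.+1 + l by lia.
  nia.
- by rewrite /catp.
- by rewrite catpR subnn.
- move=> l li; exists l; first lia.
  by rewrite !catpL //; lia.
- move=> l lj; exists ((i + d).+1 + (j - l)).+1; first lia.
  by rewrite catpR subKn.
Qed.

Lemma dqg_cons C M k y v : dqg C k y -> D v (y 0) <= M ->
  dqg (C * M + C + M + 1) k.+1 (catp 0 (fun=> v) y).
Proof.
move=> yQ vM; rewrite -[k.+1]/(0 + k).+1; apply: (@dqg_glue C) => //; try lia.
  by split=> // i j; rewrite leqn0 => ij /eqP j0; lia.
move=> i j; rewrite leqn0 => /eqP-> jk; have := yQ.2 0 j (leq0n _) jk.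
have := Dtri v (y 0) (y j); rewrite (DC (y 0) v) => h.
have : C * D (y 0) (y j) <= C * (M + D v (y j)) by apply: leq_mul => //; lia.
nia.
Qed.

Lemma last_index (p : pred nat) a b : a <= b -> p a -> ~~ p b ->
  exists l, [/\ a <= l, l < b, p l & ~~ p l.+1].
Proof.
elim: b => [|b IH]; first by rewrite leqn0 => /eqP-> ->.
rewrite leq_eqVlt => /orP[/eqP->->//|ab pa pb].
case pb' : (p b); first by exists b; rewrite pb'.
by have [|l [al lb pl pl']] := IH ab pa; [rewrite pb'|exists l; split=> //; lia].
Qed.

Definition sym_bound C A M := M + A * (A * (2 * M + C) + A).

Lemma dqg_near_sym C A M k n y P : dqg A n P ->
  (forall l, l < k -> D (y l) (y l.+1) <= C) ->
  y 0 = P 0 -> y k = P n ->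
  (forall l, l <= k -> exists2 e, e <= n & D (y l) (P e) <= M) ->
  forall f, f <= n -> exists2 l, l <= k & D (y l) (P f) <= sym_bound C A M.
Proof.
move=> PQ yS y0 yk near f fn.
pose p l := has (fun e => D (y l) (P e) <= M) (iota 0 f.+1).
have pP l : p l -> exists2 e, e <= f & D (y l) (P e) <= M.
  by case/hasP=> e; rewrite mem_iota add0n ltnS => ef; exists e.
have fin l e e' : e <= f -> f <= e' -> e' <= n -> D (y l) (P e) <= M ->
  D (P e) (P e') <= 2 * M + C -> D (y l) (P f) <= sym_bound C A M.
  move=> ef fe e'n le d; have := PQ.2 _ _ (leq_trans ef fe) e'n.
  have h := leq_mul (leqnn A) d; have := dqg_step PQ ef fn.
  have := Dtri (P e) (y l) (P f); rewrite /sym_bound.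
  have : A * (f - e) <= A * (A * D (P e) (P e') + A) ->
      A * (f - e) <= A * (A * (2 * M + C) + A).
    move=> /leq_trans; apply; apply: leq_mul => //; lia.
  move=> h1 h2 h3 h4; have : A * (f - e) <= A * (A * D (P e) (P e') + A).
    by apply: leq_mul => //; lia.
  move/h1; lia.
have p0 : p 0 by apply/hasP; exists 0; rewrite ?mem_iota // y0 Dxx.
case: (boolP (p k)) => [/pP[e ef le]|pk].
  exists k => //; apply: (fin k e n) => //.
  by rewrite -yk DC; lia.
have [l [_ lk /pP[e ef le] pl]] := last_index (leq0n k) p0 pk.
exists l; first exact: ltnW.
have [e' e'n le'] := near _ lk.
have fe' : f <= e'.
  rewrite leqNgt; apply/negP => e'f; case/hasP: pl; exists e' => //.
  by rewrite mem_iota; lia.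
apply: (fin l e e') => //.
have := Dtri (y l) (P e) (P e'); have := Dtri (y l.+1) (y l) (P e').
by have := yS _ lk; rewrite (DC (P e) (y l)); lia.
Qed.

(** * Local Morse paths *)

Definition local_qg A (m : nat -> nat) L n P := [/\
  forall i, i < n -> D (P i) (P i.+1) <= A,
  forall i j, i <= j -> j <= n -> j <= i + L -> j <= i + (A * D (P i) (P j) + A) &
  forall C k y i j, dqg C k y -> i <= j -> j <= n -> j <= i + L ->
    y 0 = P i -> y k = P j ->
    forall l, l <= k -> exists e, [/\ i <= e, e <= j & D (y l) (P e) <= m C]].

(* The statement proved by induction on [r]. *)
Definition passes Q D1 n P r := forall i j k y, i <= j -> j <= n -> j < i + r ->
  dqg Q k y -> y 0 = P i -> y k = P j ->
  forall h, i <= h -> h <= j -> exists2 l, l <= k & D (P h) (y l) <= D1.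

Definition revp n P : nat -> X := fun l => P (n - l).

Lemma local_qg_rev A m L n P : local_qg A m L n P -> local_qg A m L n (revp n P).
Proof.
move=> [PS PL PM]; split; rewrite /revp.
- move=> i iN; rewrite DC; have := PS (n - i.+1).
  by rewrite -subSn // subSS; apply; lia.
- by move=> i j ij jn jL; rewrite DC; have := PL (n - j) (n - i); lia.
- move=> C k y i j yQ ij jn jL y0 yk l lk.
  have [||||||e [e1 e2 e3]] := PM C k _ (n - j) (n - i) (dqg_rev yQ) _ _ _ _ _ (k - l);
    try lia; rewrite ?subn0 ?subnn //.
  exists (n - e); split; [lia|lia|].
  by rewrite !subKn // in e3 *; lia.
Qed.

Lemma passes_rev Q D1 n P r : passes Q D1 n P r -> passes Q D1 n (revp n P) r.
Proof.
move=> Pr i j k y ij jn jr yQ y0 yk h ih hj; rewrite /revp in y0 yk *.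
have [|||||||l lk le] := Pr (n - j) (n - i) k _ _ _ _ (dqg_rev yQ) _ _ (n - h);
  try lia; rewrite ?subn0 ?subnn //.
by exists (k - l) => //; lia.
Qed.

Lemma local_qg_sub A m L n P i j : local_qg A m L n P -> i <= j -> j <= n ->
  j <= i + L -> dqg A (j - i) (fun l => P (i + l)).
Proof.
move=> [PS PL _] ij jn jL; split=> [l lj|l l' ll lj].
  by rewrite addnS; apply: PS; lia.
by have := PL (i + l) (i + l'); lia.
Qed.

Lemma local_step A m L n P i j : local_qg A m L n P -> i <= j -> j <= n ->
  D (P i) (P j) <= A * (j - i).
Proof.
move=> [PS _ _]; elim: j => [|j IH]; first by rewrite leqn0 => /eqP->; rewrite Dxx.
rewrite leq_eqVlt => /orP[/eqP->|ij jk]; first by rewrite Dxx.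
have := IH ij (ltnW jk); have := PS _ jk; have := Dtri (P j) (P i) (P j.+1).
rewrite subSn // mulnS; lia.
Qed.

(** The constant of [dqg_cons] after moving one endpoint by at most [M]; [fuzz] accounts for both
    ends. *)
Definition fuzz1 C M := C * M + C + M + 1.
Definition fuzz C M := fuzz1 (fuzz1 C M) M.

Lemma local_near A m L n P C M k y i j : local_qg A m L n P -> dqg C k y ->
  i <= j -> j <= n -> j <= i + L -> D (P i) (y 0) <= M -> D (P j) (y k) <= M ->
  forall l, l <= k -> exists e, [/\ i <= e, e <= j & D (y l) (P e) <= m (fuzz C M)].
Proof.
move=> [_ _ PM] yQ ij jn jL y0 yk l lk.
have q1r := dqg_rev (dqg_cons yQ y0); pose y1 := catp 0 (fun=> P i) y.
have yk1 : D (P j) (y1 (k.+1 - 0)) <= M by rewrite subn0 /y1 -[k.+1]/(0 + k).+1 catpR.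
have q2 := dqg_rev (dqg_cons q1r yk1).
have := PM _ _ _ i j q2 ij jn jL.
rewrite subn0 subnn -[k.+2]/(0 + k.+1).+1 catpR subnn !catpL // => /(_ erefl erefl l.+1).
rewrite (_ : (0 + k.+1).+1 - l.+1 = (0 + (k - l)).+1); last lia.
rewrite catpR (_ : k.+1 - (k - l) = (0 + l).+1); last lia.
by rewrite catpR; apply; lia.
Qed.

Section LocalPath.
Context (A Q L D1 : nat) (m : nat -> nat).
Context (A0 : 0 < A) (AQ : 3 * A <= Q).
Implicit Types (n r h e f : nat).

(** The [9 * A] comes from applying [concat_closest] twice to an [A]-quasi-geodesic. *)
Definition close_cst := sym_bound (9 * A) A (m (9 * A)).
Context (m1D : close_cst <= D1) (DL : 6 * (A * D1) + 3 * A + 3 <= L).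

(** If [j] exceeded [i + L], the geodesic from [P i] to [P j], of length at most [M], would pass
    within [D1] of [P (i + L)]. That puts [P (i + L)] within [M + D1] of [P i], against the local
    lower bound. *)
Lemma no_return n P r i j M : local_qg A m L n P -> passes Q D1 n P r ->
  i <= j -> j <= n -> j < i + r -> A * (M + D1) + A < L -> D (P i) (P j) <= M ->
  j <= i + (A * D (P i) (P j) + A).
Proof.
move=> PL Pr ij jn jr ML d; have [PS PL' _] := PL.
have [jL|Lj] := leqP j (i + L); first exact: PL'.
have [g [g0 gD gE]] := Dgeo (P i) (P j).
have gQ : dqg Q (D (P i) (P j)) g.
  apply: (@dqgW 1); first lia.
  by split=> [l ld|l l' ll ld]; rewrite gE //; lia.
have [||l lD le] := Pr _ _ _ _ ij jn jr gQ g0 gD (i + L); [lia|lia|].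
have gl : D (P i) (g l) = l by rewrite -g0 gE ?subn0.
have := PL' i (i + L); have := Dtri (g l) (P i) (P (i + L)).
rewrite (DC (g l)) gl => h1 h2.
have : A * D (P i) (P (i + L)) <= A * (M + D1) by apply: leq_mul => //; lia.
lia.
Qed.

(** The line is joined to [P e] and to [P f0] by geodesics from closest points; [passes] makes the
    second one at most [D1] long. The Morse property on the window from [f0] to [e] then applies to
    the resulting [9 * A]-quasi-geodesic [z]. *)
Lemma track_window n P r h k c t e M f0 f : local_qg A m L n P -> passes Q D1 n P r ->
  dqg A k c -> c 0 = P h -> t <= k -> e <= n -> e < h + r ->
  D (c t) (P e) <= M -> M <= D1 -> h <= f0 -> f0 <= f ->
  f + (A * (M + close_cst) + A + 1) <= e -> e <= f0 + L ->
  f0 = h \/ f0 + (A * (D1 + close_cst) + A + 1) <= f ->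
  exists2 t', t' <= t & D (c t') (P f) <= close_cst.
Proof.
move=> PL Pr cQ c0 tk en er ct MD hf0 f0f fe eL f0P; have [PS PL' PM] := PL.
have cQt : dqg A t c by apply: (@dqg_sub A k c 0 t cQ).
have [k' [y [s [yQ y0 yk st [smin k'E yl yr]]]]] := concat_closest (P e) A0 cQt.
have [||||x xk xd] := Pr h e _ _ _ en er (dqgW AQ yQ) _ yk f0; try lia.
  by rewrite y0.
have A30 : 0 < 3 * A by lia.
have [k2 [z [s2 [zQ z0 zk s2k [s2min k2E zl zr]]]]] :=
  concat_closest (P f0) A30 (dqg_rev yQ).
rewrite !mulnA -/(9 * A) in zQ; have {}zQ := dqg_rev zQ.
have zn := PM _ _ _ f0 e zQ _ en eL; rewrite subn0 subnn z0 subn0 in zn.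
have {}zn := zn ltac:(lia) zk yk.
have [fL] : exists2 l, l <= k2 & D (z (k2 - l)) (P f) <= close_cst.
  have sub := local_qg_sub PL (_ : f0 <= e) en eL.
  have [||||l lk ld] := @dqg_near_sym (9 * A) A (m (9 * A)) k2 (e - f0)
    (fun l => z (k2 - l)) (fun l => P (f0 + l)) (sub ltac:(lia)) zQ.1 _ _ _ (f - f0); try lia.
  - by rewrite subn0 zk addn0.
  - by rewrite subnn z0 subn0 subnKC //; lia.
  - move=> l lk; have [e' [h1 h2 h3]] := zn l lk.
    by exists (e' - f0); rewrite ?subnKC //; lia.
  by exists l => //; rewrite subnKC in ld.
move=> fk; set l := k2 - fL => ld.
have lk2 : l <= k2 by rewrite /l; lia.
have near f1 M' : f0 <= f1 -> f1 <= e -> D (P f1) (P f) <= M' ->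
    f <= f1 + (A * M' + A) /\ f1 <= f + (A * M' + A).
  move=> f01 f1e d; have : A * D (P f1) (P f) <= A * M' by rewrite leq_mul2l d orbT.
  have := PL' f1 f; have := PL' f f1; rewrite (DC (P f)).
  by case: (leqP f f1); lia.
have AM : A * (M + close_cst) <= A * (D1 + close_cst) by apply: leq_mul => //; lia.
(* The point near [P f] lies on one of the two added geodesics or on the combing line. The geodesics
   stay too close to [P f0] or [P e]; when [f0 = h] the first is trivial and time [0] serves. *)
case: (leqP l s2) => ls2; last first.
  have dz := zr l (ltnW ls2) lk2.
  have df := Dtri (z l) (P f0) (P f); rewrite (DC (P f0) (z l)) in df.
  case: f0P => [f0E|f0E].
    have : D (y (k' - s2)) (P f0) = 0.
      have := s2min k' (leqnn _); rewrite subnn y0 c0 f0E Dxx; lia.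
    move=> d0; exists 0 => //; rewrite c0 -f0E; lia.
  have : D (y (k' - s2)) (P f0) <= D1.
    have := s2min (k' - x); rewrite subKn // (DC (y x)); lia.
  by move=> d0; have := near f0 (D1 + close_cst); lia.
move: ld; rewrite zl //; set q := k' - l => ld.
have qk' : q <= k' by rewrite /q; lia.
case: (leqP q s) => qs; first by exists q; [lia|rewrite -yl].
have := yr q (ltnW qs) qk'; have := smin t (leqnn _).
have := Dtri (y q) (P e) (P f); rewrite (DC (P e) (y q)).
by have := near e (M + close_cst); lia.
Qed.

(* [close_cst] depends neither on [M] nor on [D1]: a local window of the Morse
   property repairs the loss made by [passes]. *)
Lemma track n P r h k c t e M f : local_qg A m L n P -> passes Q D1 n P r ->
  dqg A k c -> c 0 = P h -> t <= k -> e <= n -> e < h + r ->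
  D (c t) (P e) <= M -> M <= D1 -> h <= f ->
  f + (A * (M + close_cst) + A + 1) <= e ->
  exists2 t', t' <= t & D (c t') (P f) <= close_cst.
Proof.
move=> PL Pr cQ c0 tk.
elim/ltn_ind: e M t tk => e IH M t tk en er ct MD hf fe.
have AM : A * (M + close_cst) <= A * (D1 + D1) by apply: leq_mul => //; lia.
have Am : A * (close_cst + close_cst) <= A * (D1 + D1) by apply: leq_mul => //; lia.
have Am' : A * (D1 + close_cst) <= A * (D1 + D1) by apply: leq_mul => //; lia.
case: (leqP e (h + L)) => eh.
  by apply: (track_window PL Pr cQ c0 tk en er ct MD _ hf fe eh); [|left].
(* If [f] lies well inside the window of length [L] ending at [e], one application suffices.
   Otherwise the recursion restarts at [e1], just before [e], where the distance is already
   [close_cst]. *)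
case: (leqP (e - L + (A * (D1 + close_cst) + A + 1)) f) => ef.
  apply: (@track_window n P r h k c t e M (e - L)) => //; try lia.
set e1 := e - (A * (M + close_cst) + A + 1).
have [|||||t1 t1t ct1] :=
  @track_window n P r h k c t e M (e - L) e1 PL Pr cQ c0 tk en er ct MD;
  rewrite /e1; try lia.
have [|||||||t2 t2t ct2] := IH e1 _ close_cst t1 _ _ _ ct1; rewrite /e1; try lia.
by exists t2 => //; lia.
Qed.

(** * Bounded combings *)

Context (T : X -> X -> nat) (c : X -> X -> nat -> X).
Context (cQ : forall z w, dqg A (T z w) (c z w)) (c0 : forall z w, c z w 0 = z)
  (cT : forall z w t, T z w <= t -> c z w t = w)
  (cB : forall z w w' t, D (c z w t) (c z w' t) <= A * D w w' + A).
Implicit Types (z w : X).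

(** The indices [f] with [reach (P h) w (P f)] record how far the combing line from [P h] to [w]
    follows the path. *)
Definition reach z w x := has (fun t => D (c z w t) x <= close_cst) (iota 0 (T z w).+1).

Lemma reachP z w x :
  reflect (exists2 t, t <= T z w & D (c z w t) x <= close_cst) (reach z w x).
Proof.
apply: (iffP hasP) => -[t tT d]; exists t => //.
  by move: tT; rewrite mem_iota ltnS.
by rewrite mem_iota ltnS.
Qed.

(** * Divergence of combing lines that leave the path *)

Section Push.
Context (K K2 N B : nat).
(** [push_weight] is the weight for [concat_optimal], [push_gap] bounds two lines at equal times,
    and [push_depth] is the time scale past departure. The constants [push_near], [push_left] and
    [push_right] do not involve [N], so [N] can be chosen after them. *)
Definition push_weight := 16 * A * K2.
Definition push_gap := A * (Q * K * N) + A.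
Definition push_depth := K2 * N.
Definition push_near := m (fuzz (3 * A + push_weight + 2) close_cst).
Definition push_left := A * (A * (push_near + close_cst) + A + 1) + push_near.
Definition push_right := push_near + A * (A * (close_cst + push_near) + A) +
  close_cst + A * (A * (close_cst + close_cst) + A + 1).
Context (K20 : 0 < K2)
  (S_large : A * (push_gap + push_near + A * (2 * N) + 2 * close_cst) + A +
     push_gap < push_depth)
  (N_large : 2 * (A * (push_left + push_right + 1)) < N)
  (B_large : A * (2 * push_depth) + close_cst <= B)
  (muD : push_near <= D1) (NL : 2 * N <= L).

(* [w] and [w'] are far from the path and their combing lines leave it around
   [f1] and [f2]: if they were close, the two lines joined at depth [push_depth]
   would give a quasi-geodesic contradicting the Morse property. *)
Lemma push n P r h w w' f1 f2 : local_qg A m L n P -> passes Q D1 n P r ->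
  h <= f1 -> f1 + N <= f2 -> f2 <= f1 + 2 * N -> f2 <= n -> f2 < h + r ->
  reach (P h) w (P f1) -> reach (P h) w' (P f2) -> ~~ reach (P h) w (P f1.+1) ->
  B < D w (P f1) -> B < D w' (P f2) -> Q * K * N < D w w'.
Proof.
move=> PL Pr hf1 f12 f21 f2n f2r /reachP[t1 t1T ct1] /reachP[t2 t2T ct2] nreach far1 far2.
rewrite ltnNge; apply/negP => ww'; set z := P h in ct1 ct2 nreach t1T t2T.
have [_ PLl _] := PL.
have f12' : f1 <= f2 by lia.
have dU t : D (c z w t) (c z w' t) <= push_gap.
  by apply: leq_trans (cB _ _ _ _) _; rewrite leq_add2r leq_mul2l ww' orbT.
have long u e t : t <= T z u -> D (c z u t) (P e) <= close_cst -> B < D u (P e) ->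
    t + 2 * push_depth <= T z u.
  move=> tT d; rewrite [_ <= T z u]leqNgt => far; apply/negP => Tt.
  have := dqg_step (cQ z u) tT (leqnn _); rewrite (cT (leqnn _)) => d'.
  have : A * (T z u - t) <= A * (2 * push_depth) by apply: leq_mul => //; lia.
  by have := Dtri (c z u t) u (P e); rewrite (DC u (c z u t)); lia.
have T1 := long _ _ _ t1T ct1 far1; have T2 := long _ _ _ t2T ct2 far2.
have dP e : f1 <= e -> e <= f2 -> D (P e) (P f2) <= A * (2 * N).
  move=> fe ef; apply: leq_trans (local_step PL ef f2n) _.
  by apply: leq_mul => //; lia.
have AS d : d <= push_gap + push_near + A * (2 * N) + 2 * close_cst ->
    A * d + A < push_depth.
  move=> dle.
  have : A * d <= A * (push_gap + push_near + A * (2 * N) + 2 * close_cst).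
    by rewrite leq_mul2l dle orbT.
  lia.
(* If [t] were later than [t' + push_depth], the line to [u'] would be near the path, hence near its
   own position at [t'], after too long a time. The index [q] caps [t] at the end of the line. *)
have sync u u' e e' t t' : (forall q, D (c z u q) (c z u' q) <= push_gap) ->
    D (P e) (P e') <= A * (2 * N) -> D (c z u t) (P e) <= close_cst ->
    D (c z u' t') (P e') <= close_cst -> t' + 2 * push_depth <= T z u' ->
    t <= t' + push_depth.
  move=> dq de dt dt' TT; rewrite leqNgt; apply/negP => tt.
  have [q [q1 q2 q3]] : exists q, [/\ t' + push_depth <= q, q <= T z u' & c z u' q = c z u' t].
    case: (leqP t (T z u')) => tT; first by exists t; split=> //; lia.
    by exists (T z u'); split; [lia|lia|rewrite !cT //; lia].
  have := (cQ z u').2 t' q; rewrite q3.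
  have : D (c z u' t') (c z u' t) <= push_gap + push_near + A * (2 * N) + 2 * close_cst.
    have := Dtri (P e') (c z u' t') (c z u' t); have := Dtri (P e) (P e') (c z u' t).
    have := Dtri (c z u t) (P e) (c z u' t); have := dq t.
    rewrite (DC (P e) (c z u t)) (DC (P e') (P e)); lia.
  by move/AS; lia.
have t12 : t1 <= t2 + push_depth by apply: (sync w w' f1 f2) => //; apply: dP.
have t21 : t2 <= t1 + push_depth.
  by apply: (sync w' w f2 f1) => //; [move=> q|]; rewrite DC //; apply: dP.
(* The first line is joined to [v], giving [y]; then [y] and the second line are cut optimally,
   which leaves a quasi-geodesic [p] from near [P f1] to near [P f2]. *)
pose v := c z w' (t2 + push_depth).
have c1Q : dqg A (2 * push_depth) (fun l => c z w (t1 + l)) by apply: dqg_sub T1.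
have c2Q : dqg A push_depth (fun l => c z w' (t2 + l)) by apply: dqg_sub (cQ _ _) _; lia.
have [k' [y [s [yQ y0 yk s2S [smin k'E yl _]]]]] := concat_closest v A0 c1Q.
have ds : D (c z w (t1 + s)) v <= push_gap.
  have := smin (t2 + push_depth - t1); rewrite subnKC // => h1.
  by apply: leq_trans (h1 _) (dU _); lia.
have weight0 : 0 < push_weight by rewrite /push_weight !muln_gt0 A0 K20.
have A30 : 0 < 3 * A by rewrite muln_gt0 A0.
have c2Q' : dqg (3 * A) push_depth (fun l => c z w' (t2 + l)) by apply: dqgW c2Q; lia.
have [i [j [k [p [ik jS pQ [p0 pk] [ijmin pi pj]]]]]] := concat_optimal A30 weight0 yQ c2Q'.
have near := local_near (M := close_cst) PL pQ f12' f2n.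
rewrite p0 pk y0 !addn0 DC (DC (P f2)) in near.
have {}near := near ltac:(lia) ct1 ct2; rewrite -/push_near in near.
(* The cut of [y] lies on the first line: otherwise [p] contains a point within [push_gap] of [v],
   so [v] is near the path, against its depth past [t2]. *)
have is_ : i < s.
  rewrite ltnNge; apply/negP => si; have [l lk pl] := pi _ si.
  have [e [e1 e2]] := near _ lk; rewrite pl yl // => de.
  have := c2Q.2 0 push_depth (leq0n _) (leqnn _); rewrite addn0.
  have : D (c z w' t2) v <= push_gap + push_near + A * (2 * N) + 2 * close_cst.
    have := Dtri (P f2) (c z w' t2) v; have := Dtri (P e) (P f2) v.
    have := Dtri (c z w (t1 + s)) (P e) v; have := dP _ e1 e2.
    rewrite (DC (P e) (P f2)) (DC (P e) (c z w _)); lia.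
  by move/AS; rewrite -/v; lia.
(* Were [y i] near some [P e] well beyond [f1.+1], then [track] would contradict [nreach]. *)
have d1 : D (y i) (P f1) <= push_left.
  have [l lk pl] := pi _ (leqnn i); have [e [e1 e2]] := near _ lk; rewrite pl => de.
  case: (leqP (f1.+1 + (A * (push_near + close_cst) + A + 1)) e) => h1.
    case/reachP: nreach.
    have [|||||t' t't d] := @track n P r h (T z w) (c z w) (t1 + i) e push_near f1.+1 PL Pr
      (cQ _ _) (c0 _ _) _ _ _ _ muD _ h1; try lia.
      by rewrite -yl // ltnW.
    by exists t' => //; lia.
  have := local_step PL e1 (leq_trans e2 f2n).
  have : A * (e - f1) <= A * (A * (push_near + close_cst) + A + 1) by apply: leq_mul => //; lia.
  by have := Dtri (P e) (y i) (P f1); rewrite (DC (P e) (P f1)) /push_left; lia.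
(* Were this point near some [P e] well before [f2], then by [track] the line would already be near
   [P e] at a time at most [t2], which bounds [j]. *)
have d2 : D (c z w' (t2 + j)) (P f2) <= push_right.
  have [l lk pl] := pj _ (leqnn j); have [e [e1 e2]] := near _ lk; rewrite pl => de.
  case: (leqP (e + (A * (close_cst + close_cst) + A + 1)) f2) => h1.
    have [|t' t't d] := @track n P r h (T z w') (c z w') t2 f2 close_cst e PL Pr
      (cQ _ _) (c0 _ _) t2T f2n f2r ct2 m1D _ h1; first lia.
    have := (cQ z w').2 t' (t2 + j).
    have : A * D (c z w' t') (c z w' (t2 + j)) <= A * (close_cst + push_near).
      apply: leq_mul => //.
      by have := Dtri (P e) (c z w' t') (c z w' (t2 + j)); rewrite (DC (P e) (c z w' (t2 + j))); lia.
    move=> h2 h3; have jle : j <= A * (close_cst + push_near) + A by lia.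
    have := c2Q; move/dqg_step => /(_ 0 j (leq0n _) jS); rewrite addn0 subn0 => h4.
    have : A * j <= A * (A * (close_cst + push_near) + A) by rewrite leq_mul2l jle orbT.
    by have := Dtri (c z w' t2) (c z w' (t2 + j)) (P f2); rewrite (DC _ (c z w' t2)) /push_right; lia.
  have := local_step PL e2 f2n.
  have : A * (f2 - e) <= A * (A * (close_cst + close_cst) + A + 1) by apply: leq_mul => //; lia.
  by have := Dtri (P e) (c z w' (t2 + j)) (P f2); rewrite /push_right; lia.
(* Optimality is compared with the uncut ends, which meet at [v] with zero jump and total length at
   most [4 * push_depth]. *)
have gap : 4 * (A * D (y i) (c z w' (t2 + j))) <= N.
  have h0 := ijmin k' push_depth (leqnn _) (leqnn _); rewrite yk Dxx muln0 in h0.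
  have h1 : push_weight * D (y i) (c z w' (t2 + j)) <= 4 * push_depth by lia.
  have h2 : 4 * K2 * (4 * (A * D (y i) (c z w' (t2 + j)))) <= 4 * K2 * N.
    by rewrite -[4 * K2 * N]mulnA (leq_trans _ h1) // /push_weight; lia.
  by move: h2; rewrite leq_pmul2l // muln_gt0.
have := PLl f1 f2 f12' f2n.
have : A * D (P f1) (P f2) <= A * (push_left + D (y i) (c z w' (t2 + j)) + push_right).
  apply: leq_mul => //.
  have := Dtri (y i) (P f1) (P f2); have := Dtri (c z w' (t2 + j)) (y i) (P f2).
  rewrite (DC (P f1) (y i)); lia.
by lia.
Qed.

(** * Progress of the departure point along the path *)

Definition adj_loss := A * (2 * close_cst + A * Q + A) + A + 1.
Definition turn_near := m (fuzz A close_cst).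
Definition turn_margin := A * (close_cst + turn_near) + A + 1.
Definition turn_range := A * (B + close_cst) + A + 1 + turn_margin.
Definition turn_close := close_cst + A * (A * (B + A * turn_range) + A).
Definition turn_bound := turn_margin + adj_loss + A * turn_close + A + 1.
Definition forward_cst := turn_bound + (A * (B + Q + close_cst) + A + 1) + 2 * N.
Context (GD : close_cst + A * Q + A <= D1) (GN : adj_loss <= N) (BD : B + Q <= D1) (N0 : 0 < N)
  (gL : 2 * turn_margin <= L) (ML : A * (turn_close + D1) + A < L).

Lemma reach_end n P r h w b M f : local_qg A m L n P -> passes Q D1 n P r ->
  b <= n -> b < h + r -> D w (P b) <= M -> M <= D1 -> h <= f ->
  f + (A * (M + close_cst) + A + 1) <= b -> reach (P h) w (P f).
Proof.
move=> PL Pr bn br d MD hf fb; apply/reachP.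
apply: (@track n P r h (T (P h) w) (c (P h) w) (T (P h) w) b M) => //.
by rewrite cT.
Qed.

(** At equal times the line to [w'] is within [A * Q + A] of the line to [w], and [track] restores
    [close_cst] at the cost of [adj_loss] indices. If the line to [w'] has already ended, [w']
    itself is near [P e]. *)
Lemma reach_adj n P r h w w' e f : local_qg A m L n P -> passes Q D1 n P r ->
  e <= n -> e < h + r -> D w w' <= Q -> reach (P h) w (P e) -> h <= f ->
  f + adj_loss <= e -> reach (P h) w' (P f).
Proof.
move=> PL Pr en er ww' /reachP[t tT d] hf fe.
have d' : D (c (P h) w' t) (P e) <= close_cst + (A * Q + A).
  have := cB (P h) w w' t; have := Dtri (c (P h) w t) (c (P h) w' t) (P e).
  have : A * D w w' <= A * Q by rewrite leq_mul2l ww' orbT.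
  by rewrite (DC (c (P h) w' t) (c (P h) w t)); lia.
apply/reachP; case: (leqP t (T (P h) w')) => tT'; last first.
  apply/reachP; apply: (@reach_end n P r h w' e (close_cst + (A * Q + A))) => //; try lia.
    by rewrite cT ?(ltnW tT') // in d'.
  by rewrite /adj_loss in fe; lia.
have [||t' t't d2] := @track n P r h _ _ t e _ f PL Pr (cQ _ _) (c0 _ _) tT' en er d' _ hf.
- lia.
- by rewrite /adj_loss in fe; lia.
by exists t' => //; lia.
Qed.

Lemma reach_mono n P r h w e f : local_qg A m L n P -> passes Q D1 n P r ->
  e <= n -> e < h + r -> reach (P h) w (P e) -> h <= f -> f + adj_loss <= e ->
  reach (P h) w (P f).
Proof. by move=> PL Pr en er; apply: (reach_adj PL Pr en er); rewrite Dxx. Qed.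

(** Read backwards from [t2], the line joins a point near [P (h - turn_margin)] to [P h], so the
    Morse property keeps it near that piece. At [t1] it would also be near [P (h + turn_margin)],
    which is too far along the path. *)
Lemma no_crossing n P r h w t1 t2 : local_qg A m L n P -> passes Q D1 n P r ->
  turn_margin <= h -> h + turn_margin <= n -> t1 <= t2 -> t2 <= T (P h) w ->
  D (c (P h) w t2) (P (h - turn_margin)) <= close_cst ->
  D (c (P h) w t1) (P (h + turn_margin)) <= close_cst -> False.
Proof.
move=> PL Pr gh hn t12 t2T d2 d1; have [_ PLl _] := PL.
have c2 : dqg A t2 (c (P h) w) by apply: (@dqg_sub A _ _ 0 t2 (cQ (P h) w)).
have c2r := dqg_rev c2.
have [||||||e [e1 e2]] := @local_near A m L n P A close_cst t2 _
  (h - turn_margin) h PL c2r _ _ _ _ _ (t2 - t1);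
  rewrite ?subn0 ?subnn ?c0 ?Dxx //; try lia.
  by rewrite DC.
rewrite subKn // -/turn_near => de.
have := PLl e (h + turn_margin).
have : A * D (P e) (P (h + turn_margin)) <= A * (close_cst + turn_near).
  apply: leq_mul => //.
  by have := Dtri (c (P h) w t1) (P e) (P (h + turn_margin)); rewrite (DC (P e) (c _ _ _)); lia.
have gE : turn_margin = A * (close_cst + turn_near) + A + 1 by [].
by lia.
Qed.
Lemma revp_rev n P l : l <= n -> revp n P (n - l) = P l.
Proof. by move=> ln; rewrite /revp subKn. Qed.

(** If [h] is far from [a], the line from [P h] to [w] follows the path backwards, by [reach_end] on
    the reversed path; following it forwards as well contradicts [no_crossing], whichever comes
    first. If [h] is near [a], the line is too short, by [no_return]. *)
Lemma turn n P r h w a e : local_qg A m L n P -> passes Q D1 n P r ->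
  a <= h -> h < a + r -> D w (P a) <= B -> h + turn_bound <= e -> e <= n -> e < h + r ->
  ~~ reach (P h) w (P e).
Proof.
move=> PL Pr ah hr wa he en er; apply/negP => we.
have E0E : turn_bound = turn_margin + adj_loss + A * turn_close + A + 1 by [].
case: (leqP (a + turn_range) h) => aG.
  have gh : turn_margin <= h by rewrite /turn_range in aG; lia.
  have hn : h + turn_margin <= n by lia.
  have /reachP[t1 t1T d1] : reach (P h) w (P (h + turn_margin)).
    by apply: (reach_mono PL Pr en er we); lia.
  have /reachP[t2 t2T d2] : reach (P h) w (P (h - turn_margin)).
    have rh : revp n P (n - h) = P h by rewrite revp_rev //; lia.
    rewrite -rh -(@revp_rev n P (h - turn_margin)); last lia.
    apply: (@reach_end n (revp n P) r (n - h) w (n - a) B); try lia.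
    - exact: local_qg_rev.
    - exact: passes_rev.
    - by rewrite revp_rev //; lia.
    - by rewrite /turn_range in aG; lia.
  case: (leqP t1 t2) => t12; first exact: (no_crossing PL Pr gh hn t12 t2T d2 d1).
  have rh : revp n P (n - h) = P h by rewrite revp_rev //; lia.
  apply: (@no_crossing n (revp n P) r (n - h) w t2 t1); rewrite ?rh //; try lia.
  - exact: local_qg_rev.
  - exact: passes_rev.
  - by rewrite (_ : n - h - turn_margin = n - (h + turn_margin)) ?revp_rev //; lia.
  - by rewrite (_ : n - h + turn_margin = n - (h - turn_margin)) ?revp_rev //; lia.
case/reachP: we => t tT d.
have wh : D w (P h) <= B + A * turn_range.
  have := local_step PL ah.
  have : A * (h - a) <= A * turn_range by apply: leq_mul => //; lia.
  have := Dtri (P a) w (P h); lia.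
have Tle : T (P h) w <= A * (B + A * turn_range) + A.
  have := (cQ (P h) w).2 0 _ (leq0n _) (leqnn _); rewrite c0 cT // (DC (P h)).
  have : A * D w (P h) <= A * (B + A * turn_range) by rewrite leq_mul2l wh orbT.
  lia.
have d' : D (P h) (P e) <= turn_close.
  have := dqg_step (cQ (P h) w) (leq0n t) tT; rewrite c0 subn0.
  have : A * t <= A * (A * (B + A * turn_range) + A) by apply: leq_mul => //; lia.
  by have := Dtri (c (P h) w t) (P h) (P e); rewrite /turn_close; lia.
have he' : h <= e by lia.
have := no_return PL Pr he' en er ML d'.
have : A * D (P h) (P e) <= A * turn_close by rewrite leq_mul2l d' orbT.
lia.
Qed.

Lemma progress n P r h a b k y q : local_qg A m L n P -> passes Q D1 n P r ->
  a <= h -> h <= b -> b <= n -> h < a + r -> b < h + r -> dqg Q k y ->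
  D (y 0) (P a) <= B ->
  (forall l, l < k -> forall e, h <= e -> e <= b -> B < D (y l) (P e)) ->
  h + turn_bound + q * (N + adj_loss) <= b -> forall l, l < k ->
  reach (P h) (y l) (P (h + turn_bound + q * (N + adj_loss))) -> q * (K * N) <= l.
Proof.
move=> PL Pr ah hb bn har hbr yQ y0 far.
elim: q => // q IH qb l lk; rewrite !mulSn in qb *.
set th := h + turn_bound + q * (N + adj_loss) in IH *.
rewrite (_ : h + turn_bound + _ = th + (N + adj_loss)); last first.
  by rewrite /th; lia.
have thb : th + (N + adj_loss) <= b by rewrite /th; lia.
have {}IH := IH ltac:(rewrite /th in thb; lia) => yl.
have hth : h + turn_bound <= th by apply: leq_addr.
clearbody th; clear qb.
(* Where [p] switches from true to false, [y s.+1] reaches an index at least [th + adj_loss], so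
   [y s] reaches [th]. The departure index [f1] of [y s] then lies between these two, and [push]
   compares [y s] with [y l]. *)
pose p s := ~~ has (fun e => reach (P h) (y s) (P e))
  (iota (th + adj_loss) (b - (th + adj_loss)).+1).
have pP s e : p s -> th + adj_loss <= e -> e <= b -> ~~ reach (P h) (y s) (P e).
  move=> /hasPn ps e1 e2; apply: ps; rewrite mem_iota; lia.
have p0 : p 0.
  apply/hasPn => e; rewrite mem_iota => /andP[e1 e2].
  by apply: (turn PL Pr ah har y0); lia.
have pl : ~~ p l.
  by rewrite negbK; apply/hasP; exists (th + (N + adj_loss)) => //; rewrite mem_iota; lia.
have [s [_ sl ps]] := last_index (leq0n l) p0 pl; rewrite negbK => /hasP[e].
rewrite mem_iota => /andP[e1 e2] re.
have rs : reach (P h) (y s) (P th).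
  apply: (@reach_adj n P r h (y s.+1) (y s) e) => //; try lia.
  by rewrite DC; apply: yQ.1; lia.
have ths := IH s (ltn_trans sl lk) rs.
have [|f1 [f1a f1b rf nrf]] := @last_index
  (fun f => reach (P h) (y s) (P f)) th (th + adj_loss) (leq_addr _ _) rs.
  by apply: pP => //; lia.
have Hpush : Q * K * N < D (y s) (y l).
  have h1 : h <= f1 by lia.
  have h2 : f1 + N <= th + (N + adj_loss) by lia.
  have h3 : th + (N + adj_loss) <= f1 + 2 * N by lia.
  apply: (push PL Pr h1 h2 h3 (leq_trans thb bn) (leq_ltn_trans thb hbr) rf yl nrf).
    by apply: far (ltn_trans sl lk) _ h1 _; lia.
  by apply: far lk _ _ thb; lia.
have sQ : D (y s) (y l) <= Q * (l - s) by apply: (dqg_step yQ (ltnW sl) (ltnW lk)).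
have : Q * (K * N) < Q * (l - s) by rewrite mulnA; apply: leq_trans sQ.
by rewrite ltn_mul2l => /andP[_]; lia.
Qed.

(** A block of [N + adj_loss <= 2 * N] indices costs [K * N] steps, whence the factor [2]. As [y k]
    may be close to the path, [progress] is applied to its predecessor, which is within [B + Q] of
    [P b]. *)
Lemma forward n P r h a b k y : local_qg A m L n P -> passes Q D1 n P r ->
  a <= h -> h <= b -> b <= n -> h < a + r -> b < h + r -> dqg Q k y ->
  D (y 0) (P a) <= B -> D (y k) (P b) <= B ->
  (forall l, l < k -> forall e, h <= e -> e <= b -> B < D (y l) (P e)) ->
  K * (b - h) <= 2 * k + K * forward_cst.
Proof.
move=> PL Pr ah hb bn har hbr yQ y0 yk far.
pose H := A * (B + Q + close_cst) + A + 1.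
have AB : A * (B + close_cst) <= A * (B + Q + close_cst) by apply: leq_mul => //; lia.
have E1E : forward_cst = turn_bound + H + 2 * N by [].
case: (leqP (h + turn_bound + H) b) => bE; last first.
  have : K * (b - h) <= K * forward_cst by apply: leq_mul => //; lia.
  lia.
case: k yQ yk far => [|k] yQ yk far.
  have := turn PL Pr ah har y0 (leqnn (h + turn_bound)) ltac:(lia) ltac:(lia).
  by rewrite (reach_end PL Pr bn hbr yk) //; rewrite /H in bE; lia.
pose q := (b - H - (h + turn_bound)) %/ (N + adj_loss).
have q1 : q * (N + adj_loss) <= b - H - (h + turn_bound) by apply: leq_trunc_div.
have q2 : b - H - (h + turn_bound) < q.+1 * (N + adj_loss) by apply: ltn_ceil; lia.
have yk' : D (y k) (P b) <= B + Q.
  by have := yQ.1 k (ltnSn k); have := Dtri (y k.+1) (y k) (P b); lia.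
have := @progress n P r h a b k.+1 y q PL Pr ah hb bn har hbr yQ y0 far ltac:(lia) k (ltnSn k).
have -> : reach (P h) (y k) (P (h + turn_bound + q * (N + adj_loss))).
  by apply: (reach_end PL Pr bn hbr yk') => //; rewrite /H in bE q1 *; lia.
move=> /(_ isT) qk; have bh : b - h <= forward_cst + q * (2 * N).
  have : q * (N + adj_loss) <= q * (2 * N) by apply: leq_mul => //; lia.
  by rewrite mulSn in q2; lia.
have : K * (b - h) <= K * (forward_cst + q * (2 * N)) by rewrite leq_mul2l bh orbT.
lia.
Qed.

Context (KA : K = 8 * Q * A) (DE : A * (2 * B + 1 + 4 * forward_cst) + B <= D1).

(** For [h] strictly between [i] and [j], both pieces of the path at [h] are short enough for the
    induction hypothesis, so [forward] holds on both sides and [drift_bound] bounds [b - a]. *)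
Lemma passes_step n P r : local_qg A m L n P -> passes Q D1 n P r ->
  passes Q D1 n P r.+1.
Proof.
move=> PL Pr i j k y ij jn jr yQ y0 yk h ih hj.
have [->|hi] := eqVneq h i; first by exists 0; rewrite // y0 Dxx.
have [->|hj'] := eqVneq h j; first by exists k; rewrite // yk Dxx.
pose near e f l := has (fun s => D (y l) (P s) <= B) (iota e (f - e).+1).
have nearP e f l : near e f l -> e <= f -> exists s, [/\ e <= s, s <= f & D (y l) (P s) <= B].
  by case/hasP=> s; rewrite mem_iota => /andP[s1 s2] d ef; exists s; split=> //; lia.
have nearN e f l s : ~~ near e f l -> e <= s -> s <= f -> B < D (y l) (P s).
  by move=> /hasPn nl es sf; rewrite ltnNge; apply: nl; rewrite mem_iota; lia.
have nk : exists l, near h j l.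
  by exists k; apply/hasP; exists j; rewrite ?yk ?Dxx // mem_iota; lia.
(* [lb] is the first index at which [y] is within [B] of the path after [h], and [la] the last one
   up to [lb] within [B] of the path before [h]. Strictly between them [y] is far from both
   parts. *)
have [lb nlb lbmin] := ex_minnP nk.
have lbk : lb <= k.
  by apply: lbmin; apply/hasP; exists j; rewrite ?yk ?Dxx // mem_iota; lia.
have n0 : exists l, near i h l && (l <= lb).
  by exists 0; rewrite andbT; apply/hasP; exists i; rewrite ?y0 ?Dxx // mem_iota; lia.
have n0b l : near i h l && (l <= lb) -> l <= lb by case/andP.
have [la /andP[nla lab] lamax] := ex_maxnP n0 n0b.
have [b [hb bj db]] := nearP _ _ _ nlb hj; have [a [ia ah da]] := nearP _ _ _ nla ih.
pose k' := lb - la; pose y' := fun l => y (la + l).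
have y'Q : dqg Q k' y' by apply: dqg_sub yQ _; rewrite /k'; lia.
have y'0 : D (y' 0) (P a) <= B by rewrite /y' addn0.
have y'k : D (y' k') (P b) <= B by rewrite /y' /k' subnKC.
have fwd : K * (b - h) <= 2 * k' + K * forward_cst.
  apply: (forward PL Pr ah hb _ _ _ y'Q y'0 y'k); try lia.
  move=> l lk e he eb; apply: (@nearN h j); try lia.
  by apply: contraL (_ : la + l < lb) => [/lbmin|]; [rewrite -leqNgt|rewrite /k' in lk; lia].
have bwd : K * (h - a) <= 2 * k' + K * forward_cst.
  rewrite (_ : h - a = (n - a) - (n - h)); last lia.
  apply: (@forward n (revp n P) r (n - h) (n - b) (n - a) k' (fun l => y' (k' - l)));
    rewrite ?subn0 ?subnn ?revp_rev //; try lia.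
  - exact: local_qg_rev.
  - exact: passes_rev.
  - exact: dqg_rev.
  move=> l lk e he eb; apply: (@nearN i h); try lia.
  apply: contraL (_ : la < la + (k' - l)) => [nl|]; last lia.
  by rewrite -leqNgt; apply: lamax; rewrite nl /k'; lia.
have len := y'Q.2 0 k' (leq0n _) (leqnn _).
have dab : D (y' 0) (y' k') <= 2 * B + A * (b - a).
  have := local_step PL (leq_trans ah hb) (leq_trans bj jn).
  have := Dtri (P a) (y' 0) (y' k'); have := Dtri (P b) (P a) (y' k').
  by rewrite (DC (P b) (y' k')); lia.
have len' : k' <= Q * (2 * B + A * (b - a)) + Q.
  by rewrite (leq_trans len) // add0n leq_add2r leq_mul2l dab orbT.
have ba : b - a <= 2 * B + 1 + 4 * forward_cst.
  by rewrite KA in fwd bwd; apply: (drift_bound A0 _ _ fwd bwd len'); lia.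
exists lb => //; have := local_step PL hb (leq_trans bj jn).
have : A * (b - h) <= A * (2 * B + 1 + 4 * forward_cst) by apply: leq_mul => //; lia.
have := Dtri (P b) (P h) (y lb); rewrite (DC (P b) (y lb)); lia.
Qed.

Lemma passes_all n P r : local_qg A m L n P -> passes Q D1 n P r.
Proof.
move=> PL; elim: r => [|r IH]; last exact: passes_step.
by move=> i j k y ij _; rewrite addn0 ltnNge ij.
Qed.

End Push.
End LocalPath.

(** * Choice of constants and the discrete theorem *)

Lemma passes_exist A Q m : 0 < A -> 3 * A <= Q -> exists L D1, forall T c,
  (forall z w, dqg A (T z w) (c z w)) -> (forall z w, c z w 0 = z) ->
  (forall z w t, T z w <= t -> c z w t = w) ->
  (forall z w w' t, D (c z w t) (c z w' t) <= A * D w w' + A) ->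
  forall n P, local_qg A m L n P -> (forall r, passes Q D1 n P r) /\
    forall i j, i <= j -> j <= n -> D (P i) (P j) <= 2 * D1 ->
      j <= i + (A * D (P i) (P j) + A).
Proof.
move=> A0 AQ.
(* Each constant depends only on the earlier ones, and [L] comes last. *)
have [K KE] : exists K, K = 8 * Q * A by eexists.
have [K2 K2E] : exists K2, K2 = A * (A * (Q * K) + 4 + 2 * A) + 2 + A * (Q * K) + 1 by eexists.
have [N NE] : exists N, N = push_near A m K2 + close_cst A m + A +
  2 * (A * (push_left A m K2 + push_right A m K2 + 1)) + adj_loss A Q m + 1 by eexists.
have [B BE] : exists B, B = A * (2 * (K2 * N)) + close_cst A m +
  push_near A m K2 + A * Q + A + Q by eexists.
have [D1 D1E] : exists D1,
  D1 = A * (2 * B + 1 + 4 * forward_cst A Q m N B) + B + Q by eexists.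
have [L LE] : exists L, L = 6 * (A * D1) + 3 * A + 3 + 2 * N + 2 * turn_margin A m +
  A * (turn_close A m B + D1) + A + 1 + A * (2 * D1 + D1) + A + 1 by eexists.
exists L, D1 => T c cQ c0 cT cB n P PL.
have N0 : 0 < N by lia.
(* Once the constants are bounded by [N], both sides are linear in [N], and [K2] exceeds the
   coefficient on the left. *)
have S_large : A * (push_gap A Q K N + push_near A m K2 + A * (2 * N) +
    2 * close_cst A m) + A + push_gap A Q K N < push_depth K2 N.
  have UE : push_gap A Q K N <= A * (Q * K) * N + N by rewrite /push_gap; lia.
  have : A * (push_gap A Q K N + push_near A m K2 + A * (2 * N) + 2 * close_cst A m) <=
      A * (A * (Q * K) + 4 + 2 * A) * N.
    by rewrite -mulnA leq_mul2l; apply/orP; right; lia.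
  rewrite /push_depth K2E !mulnDl; lia.
have Pr : forall r, passes Q D1 n P r.
  move=> r; apply: (@passes_all A Q L D1 m A0 AQ _ _ T c cQ c0 cT cB K K2 N B) => //;
    rewrite ?[push_depth _ _]/(K2 * N); lia.
split=> // i j ij jn d.
by apply: (no_return A0 AQ _ _ PL (Pr (j - i).+1) ij jn _ _ d); lia.
Qed.

Theorem local_to_global A Q m : 0 < A -> 3 * A <= Q -> exists L W M, forall T c,
  (forall z w, dqg A (T z w) (c z w)) -> (forall z w, c z w 0 = z) ->
  (forall z w t, T z w <= t -> c z w t = w) ->
  (forall z w w' t, D (c z w t) (c z w' t) <= A * D w w' + A) ->
  forall n P, local_qg A m L n P ->
    dqg W n P /\
    forall k y i j, i <= j -> j <= n -> dqg Q k y -> y 0 = P i -> y k = P j ->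
      forall l, l <= k -> exists e, [/\ i <= e, e <= j & D (P e) (y l) <= M].
Proof.
move=> A0 AQ; have [L [D1 core]] := passes_exist m A0 AQ.
have [W WE] : exists W, W = A * (2 * D1) + A + 1 by eexists.
exists L, W, (sym_bound A Q D1) => T c cQ c0 cT cB n P PL.
have [Pr ret] := core T c cQ c0 cT cB n P PL; have [PS _ _] := PL; split.
  split=> [i iN|i j ij jn]; first by rewrite (leq_trans (PS _ iN)) // WE; lia.
  have [y [y0 yk yE]] := Dgeo (P i) (P j); set k := D (P i) (P j) in yk yE *.
  have yQ : dqg Q k y.
    by apply: (@dqgW 1); [lia|split=> [l ld|l l' ll ld]; rewrite yE //; lia].
  (* Marks spaced [W] apart on the path are sent to nearby points of the geodesic [y]. Two marks
     with one image would be within [2 * D1], hence fewer than [W] indices apart; so [q <= k]. *)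
  pose q := (j - i) %/ W.
  have qW s : s <= q -> i + s * W <= j.
    move=> sq; have := leq_trunc_div (j - i) W.
    by have := leq_mul sq (leqnn W); rewrite -/q; lia.
  have /fin_all_exists [F FP] : forall s : 'I_q.+1, exists l : 'I_k.+1,
      D (P (i + s * W)) (y l) <= D1.
    move=> s; have [|||l lk ld] := Pr _ _ _ _ _ ij jn (_ : j < i + (j - i).+1) yQ y0 yk (i + s * W).
    - lia.
    - lia.
    - by apply: qW; rewrite -ltnS.
    by exists (Ordinal (lk : l < k.+1)).
  have Fi : injective F.
    suff lt (s s' : 'I_q.+1) : s < s' -> F s <> F s'.
      by move=> s s' ss; apply: val_inj; case: (ltngtP s s') => // /lt; rewrite ss.
    move=> ss FF; have := FP s; have := FP s'; rewrite FF => d1 d2.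
    have d : D (P (i + s * W)) (P (i + s' * W)) <= 2 * D1.
      by have := Dtri (y (F s')) (P (i + s * W)) (P (i + s' * W)); rewrite (DC (y _)); lia.
    have sW : s.+1 * W <= s' * W by rewrite leq_mul2r ss orbT.
    rewrite mulSn in sW.
    have sn := qW s' (ltn_ord s').
    have := ret (i + s * W) (i + s' * W) ltac:(lia) (leq_trans sn jn) d.
    have : A * D (P (i + s * W)) (P (i + s' * W)) <= A * (2 * D1).
      by rewrite leq_mul2l d orbT.
    lia.
  have := leq_card F Fi; rewrite !card_ord ltnS => qk.
  have : j - i < q.+1 * W by apply: ltn_ceil; lia.
  have := leq_mul qk (leqnn W); rewrite mulSn; lia.
move=> k y i j ij jn yQ y0 yk l lk.
(* The roles are exchanged: the path is the coarse curve staying near the quasi-geodesic [y]. *)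
have [||||s sj sd] := @dqg_near_sym A Q D1 (j - i) k (fun l => P (i + l)) y yQ _ _ _ _ l lk.
- by move=> s sj; rewrite addnS; apply: PS; lia.
- by rewrite addn0 y0.
- by rewrite subnKC.
- move=> s sj; have [|||l' l'k d] := Pr _ _ _ _ _ ij jn (_ : j < i + (j - i).+1) yQ y0 yk (i + s).
  + lia.
  + lia.
  + lia.
  by exists l'.
by exists (i + s); split=> //; lia.
Qed.

End DiscreteQuasiGeodesics.

Import Order.TTheory GRing.Theory Num.Theory.
Import numFieldNormedType.Exports.

Local Open Scope classical_set_scope.
Local Open Scope ring_scope.

(** * From metric spaces to integer distances *)

Section MetricSpaces.
Context {R : realType}.

Definition nceil (r : R) : nat := `|Num.ceil r|%N.

Lemma nceil_ge (r : R) : 0 <= r -> r <= (nceil r)%:R.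
Proof.
move=> r0; have c0 : 0 <= Num.ceil r by rewrite ceil_ge0 (lt_le_trans _ r0) // ltrN10.
by rewrite /nceil natr_absz ger0_norm // ceil_ge.
Qed.

Lemma nceil_le (r : R) n : 0 <= r -> (nceil r <= n)%N = (r <= n%:R).
Proof.
move=> r0; have c0 : 0 <= Num.ceil r by rewrite ceil_ge0 (lt_le_trans _ r0) // ltrN10.
by rewrite /nceil -lez_nat gez0_abs // ceil_le_int.
Qed.

Lemma nceil_lt (r : R) : 0 <= r -> (nceil r)%:R < r + 1.
Proof.
move=> r0; have c0 : 0 <= Num.ceil r by rewrite ceil_ge0 (lt_le_trans _ r0) // ltrN10.
rewrite /nceil natr_absz ger0_norm //.
by have := ceilB1_lt r; rewrite intrD; lra.
Qed.

Context {X : metricType R}.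
Implicit Types (x y z : X) (g : R -> X).

(* Rounding up turns a geodesic space into one with integer distances, in which
   any two points are still joined by a discrete geodesic. *)
Definition ndist x y : nat := nceil (mdist x y).

Lemma ndist_le x y n : (ndist x y <= n)%N = (mdist x y <= n%:R).
Proof. exact/nceil_le/mdist_ge0. Qed.

Lemma mdist_le_ndist x y : mdist x y <= (ndist x y)%:R.
Proof. exact/nceil_ge/mdist_ge0. Qed.

Lemma ndist_lt x y : (ndist x y)%:R < mdist x y + 1.
Proof. exact/nceil_lt/mdist_ge0. Qed.

Lemma ndistxx x : ndist x x = 0%N.
Proof. by apply/eqP; rewrite -leqn0 ndist_le mdistxx. Qed.

Lemma ndistC x y : ndist x y = ndist y x.
Proof. by rewrite /ndist metric_sym. Qed.

Lemma ndist_triangle y x z : (ndist x z <= ndist x y + ndist y z)%N.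
Proof.
rewrite ndist_le natrD (le_trans (metric_triangle x y z)) //.
by rewrite lerD // mdist_le_ndist.
Qed.

(** A geodesic is cut into [ndist x y] equal parts of length at most one. The bounds [j - i] are
    attained, since a deficit would shorten the total below [ndist x y]. *)
Lemma ndist_geodesic : geodesic_space X -> forall x y, exists g : nat -> X,
  [/\ g 0%N = x, g (ndist x y) = y & forall i j, (i <= j)%N ->
    (j <= ndist x y)%N -> ndist (g i) (g j) = (j - i)%N].
Proof.
move=> geo x y; have [g [g0 gd gE]] := geo x y.
set d := mdist x y in gd gE; set n := ndist x y.
have d0 : 0 <= d by apply: mdist_ge0.
have dn : d <= n%:R by apply: mdist_le_ndist.
have e0 : (fun i : nat => g (i%:R * (d / n%:R))) 0%N = x by rewrite mul0r.
have en : (fun i : nat => g (i%:R * (d / n%:R))) n = y.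
  have [n0|n0] := eqVneq n 0%N; last by rewrite mulrC divfK // pnatr_eq0.
  have d00 : d = 0 by apply/eqP; rewrite eq_le d0 andbT -(_ : n%:R = 0 :> R) // n0.
  by rewrite n0 mul0r -d00.
exists (fun i => g (i%:R * (d / n%:R))); split=> // i j ij jn.
have n0 : (0 <= n%:R :> R) by [].
have u0 : 0 <= d / n%:R by rewrite divr_ge0.
have step a b : (a <= b)%N -> (b <= n)%N ->
    (ndist (g (a%:R * (d / n%:R))%R) (g (b%:R * (d / n%:R))%R) <= b - a)%N.
  move=> ab bn; rewrite ndist_le.
  have inI c : (c <= n)%N -> c%:R * (d / n%:R) \in `[0, d].
    move=> cn; rewrite in_itv /= mulr_ge0 //=.
    have [n00|n00] := eqVneq n 0%N; first by rewrite n00 invr0 mulr0 mulr0.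
    by rewrite mulrCA ler_piMr // ler_pdivrMr ?mul1r ?ler_nat // ltr0n lt0n.
  rewrite gE ?inI // ?(leq_trans ab) //.
  rewrite distrC -mulrBl -natrB // ger0_norm ?mulr_ge0 //.
  rewrite ler_piMr //; have [n00|n00] := eqVneq n 0%N; first by rewrite n00 invr0 mulr0.
  by rewrite ler_pdivrMr ?mul1r // ltr0n lt0n.
apply/eqP; rewrite eqn_leq step //=.
have := step 0%N i (leq0n _) (leq_trans ij jn); have := step j n jn (leqnn _).
rewrite e0 en; set gi := g (i%:R * _); set gj := g (j%:R * _).
have := ndist_triangle gi x y; have := ndist_triangle gj gi y.
rewrite -/n; lia.
Qed.

(** * Arc length and improved quasi-geodesics *)

Lemma polygonal_length_cons g a b t s : polygonal_length g a b (t :: s) =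
  mdist (g a) (g t) + polygonal_length g t b s.
Proof. by rewrite /polygonal_length big_nat_recl. Qed.

Lemma polygonal_length_nil g a b : polygonal_length g a b [::] = 0.
Proof. by rewrite /polygonal_length big_nil. Qed.

Lemma arc_length_leP g a b (u : R) : (arc_length g a b <= u%:E)%E <->
  forall s, itv_partition a b s -> polygonal_length g a b s <= u.
Proof.
split=> [le s sP|le].
  rewrite -lee_fin (le_trans _ le) //; apply: ereal_sup_ubound.
  by exists s.
by apply: ge_ereal_sup => _ [s sP <-]; rewrite lee_fin; apply: le.
Qed.

Lemma arc_length_lipschitz g (a b C : R) :
  (forall s t : R, a <= s -> s <= t -> t <= b -> mdist (g s) (g t) <= C * (t - s)) ->
  (arc_length g a b <= (C * (b - a))%:E)%E.
Proof.
move=> lip; apply/arc_length_leP => s; elim: s a lip => [|t s IH] a lip sP.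
  by rewrite (itv_partition_nil sP) polygonal_length_nil subrr mulr0.
have tb := itv_partition_le (itv_partition_cons sP).
have at_ : a <= t by case: sP => /= /andP[/ltW].
rewrite polygonal_length_cons (_ : C * (b - a) = C * (t - a) + C * (b - t)); last first.
  by ring.
rewrite lerD ?lip ?IH //; last exact: itv_partition_cons sP.
by move=> u v tu; apply: lip; apply: le_trans tu.
Qed.

Lemma polygonal_length_split g (a c b : R) s : a <= c -> c <= b -> itv_partition a b s ->
  exists s1 s2, [/\ itv_partition a c s1, itv_partition c b s2 &
    polygonal_length g a b s <= polygonal_length g a c s1 + polygonal_length g c b s2].
Proof.
elim: s a => [|t s IH] a; rewrite le_eqVlt => /predU1P[->|ac] cb sP.
- by exists [::], [::]; split=> //; rewrite !polygonal_length_nil addr0.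
- by rewrite (itv_partition_nil sP) in ac; rewrite ltNge cb in ac.
- by exists [::], (t :: s); split=> //; rewrite polygonal_length_nil add0r.
case: (leP t c) => tc.
  have [s1 [s2 [s1P s2P le]]] := IH t tc cb (itv_partition_cons sP).
  exists (t :: s1), s2; split=> //.
    case: sP s1P => /= /andP[at_ _] _ [s1P s1l]; split=> //=.
    by rewrite at_.
  by rewrite !polygonal_length_cons -addrA lerD2l.
exists [:: c], (t :: s); split; first exact: itv_partition1.
  case: sP => /= /andP[_ ts] sl; split=> //=; by rewrite tc.
rewrite !polygonal_length_cons polygonal_length_nil addr0 addrA lerD2r.
exact: metric_triangle.
Qed.

Lemma arc_length_cat g (a c b u v : R) : a <= c -> c <= b ->
  (arc_length g a c <= u%:E)%E -> (arc_length g c b <= v%:E)%E ->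
  (arc_length g a b <= (u + v)%:E)%E.
Proof.
move=> ac cb /arc_length_leP le1 /arc_length_leP le2; apply/arc_length_leP => s sP.
have [s1 [s2 [s1P s2P le]]] := polygonal_length_split g ac cb sP.
by rewrite (le_trans le) // lerD ?le1 ?le2.
Qed.

Lemma lipschitz_within (I : set R) g (C : R) : 0 <= C ->
  (forall s t, I s -> I t -> mdist (g s) (g t) <= C * `|s - t|) ->
  {within I, continuous g}.
Proof.
move=> C0 lip; apply/subspace_continuousP => s Is.
move=> U /nbhs_ballP[e /= e0 eU].
have d0 : 0 < e / (C + 1) by rewrite divr_gt0 // ltr_wpDl.
suff : \forall t \near s, I t -> U (g t) by [].
apply/nbhs_ballP; exists (e / (C + 1)) => //= t; rewrite /ball /= => st It.
apply: eU; rewrite ballEmdist /=; apply: le_lt_trans (lip _ _ Is It) _.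
move: st; rewrite ltr_pdivlMr ?ltr_wpDl //; apply: le_lt_trans.
by rewrite mulrC ler_wpM2l // lerDl.
Qed.

(** The lower bound turns a length estimate linear in [t - s] into one linear in the distance, which
    the improvement constants of the pair [(c, c)] dominate. *)
Lemma quasi_geodesic_intro (c : R) (I : set R) g : 1 <= c -> closed_interval I ->
  {within I, continuous g} ->
  (forall s t, I s -> I t -> s <= t -> mdist (g s) (g t) <= c * (t - s) + c) ->
  (forall s t, I s -> I t -> s <= t -> t - s <= c * mdist (g s) (g t) + c) ->
  (forall s t, I s -> I t -> s <= t -> (arc_length g s t <= (c * (t - s) + c)%:E)%E) ->
  quasi_geodesic c c I g.
Proof.
move=> c1 Ii gc up low arc; have c0 : 0 < c by lra.
have key s t : I s -> I t -> s <= t ->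
    c^-1 * (t - s) - c <= mdist (g s) (g t) <= c * (t - s) + c.
  move=> Is It st; rewrite up // andbT lerBlDr mulrC ler_pdivrMr //.
  by have := low _ _ Is It st; nra.
split=> // [s t Is It|s t Is It st].
  have [st|/ltW st] := leP s t.
    by rewrite distrC ger0_norm ?subr_ge0 //; apply: key.
  by rewrite metric_sym ger0_norm ?subr_ge0 //; apply: key.
apply: le_trans (arc _ _ Is It st) _; rewrite lee_fin /improve_k1 /improve_k2.
have := low _ _ Is It st; have := mdist_ge0 (g s) (g t).
set d := mdist _ _ => d0 l; have : c * (t - s) <= c * (c * d + c) by rewrite ler_pM2l.
nra.
Qed.


(** * Interpolation and sampling *)

(** Rounding two times down to integers moves each point by at most [C]; the lower bound becomes
    [C * (d + 2 * C + 1) + C + 1], whose constant term this is. *)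
Definition interp_cst (C : nat) : R := 2 * C%:R * C%:R + 2 * C%:R + 1.

Lemma truncn_bounds (r : R) : 0 <= r ->
  (Num.truncn r)%:R <= r /\ r < (Num.truncn r)%:R + 1.
Proof. by move=> /truncn_itv/andP[]; rewrite -natr1. Qed.

Lemma interpolate C k (y : nat -> X) : geodesic_space X -> (0 < C)%N ->
  dqg ndist C k y -> exists g : R -> X,
    (forall l, (l <= k)%N -> g l%:R = y l) /\
    quasi_geodesic (interp_cst C) (interp_cst C) `[0, k%:R]%classic g.
Proof.
move=> geo C0 [yS yL]; pose y' i := y (minn i k).
have y'S i : mdist (y' i) (y' i.+1) <= C%:R.
  rewrite -ndist_le /y'; have [ik|] := boolP (i < k)%N; last rewrite -leqNgt => ik.
    by rewrite (minn_idPl (ltnW ik)) (minn_idPl ik); apply: yS.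
  by rewrite (minn_idPr ik) (minn_idPr (leqW ik)) ndistxx.
have /choice[f fP] : forall i, exists f : R -> X, [/\ f 0 = y' i, f 1 = y' i.+1 &
    forall s t : R, 0 <= s -> s <= t -> t <= 1 -> mdist (f s) (f t) <= C%:R * (t - s)].
  move=> i; have [g [g0 g1 gE]] := geo (y' i) (y' i.+1).
  have d0 := mdist_ge0 (y' i) (y' i.+1); move: (mdist _ _) d0 (y'S i) g1 gE => d d0 dC g1 gE.
  exists (fun s => g (s * d)); rewrite mul0r mul1r; split=> // s t s0 st t1.
  rewrite gE ?in_itv /= ?mulr_ge0 ?ler_piMl ?(le_trans st) // ?(le_trans s0) //.
  by rewrite distrC -mulrBl ger0_norm ?mulr_ge0 ?subr_ge0 // mulrC ler_wpM2r ?subr_ge0.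
pose g (t : R) := f (Num.truncn t) (t - (Num.truncn t)%:R).
have gN i : g i%:R = y' i by rewrite /g natrK subrr; have [] := fP i.
have y'L i j : (i <= j)%N -> mdist (y' i) (y' j) <= C%:R * (j%:R - i%:R).
  elim: j => [|j IH]; first by rewrite leqn0 => /eqP->; rewrite mdistxx subrr mulr0.
  rewrite leq_eqVlt => /predU1P[->|ij]; first by rewrite mdistxx subrr mulr0.
  have := metric_triangle (y' i) (y' j) (y' j.+1); have := IH ij; have := y'S j.
  by rewrite -natr1; lra.
have lip (s t : R) : 0 <= s -> s <= t -> mdist (g s) (g t) <= C%:R * (t - s).
  move=> s0 st; have t0 := le_trans s0 st.
  have [is_ si] := truncn_bounds s0; have [jt tj] := truncn_bounds t0.
  have := le_truncn st; rewrite /g.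
  move: (Num.truncn s) (Num.truncn t) is_ si jt tj => i j is_ si jt tj.
  have [_ fi fL] := fP i; have [fj _ fL'] := fP j.
  rewrite leq_eqVlt => /predU1P[ij|ij].
    subst j; have := fL (s - i%:R) (t - i%:R) ltac:(lra) ltac:(lra) ltac:(lra).
    by rewrite opprB addrA subrK.
  have h1 := fL (s - i%:R) 1 ltac:(lra) ltac:(lra) (lexx _); rewrite fi in h1.
  have h2 := y'L _ _ ij.
  have h3 := fL' 0 (t - j%:R) (lexx _) ltac:(lra) ltac:(lra); rewrite fj in h3.
  have h4 := metric_triangle (f i (s - i%:R)) (y' i.+1) (f j (t - j%:R)).
  have h5 := metric_triangle (y' i.+1) (y' j) (f j (t - j%:R)).
  move: h1 h2 h3; rewrite -natr1 !mulrBr mulrDr mulr1 mulr0; lra.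
have C1 : 1 <= C%:R :> R by rewrite ler1n.
have cE : interp_cst C = 2 * C%:R * C%:R + 2 * C%:R + 1 by [].
have cC : C%:R <= interp_cst C by rewrite cE; nra.
exists g; split=> [l lk|]; first by rewrite gN /y' (minn_idPl lk).
apply: quasi_geodesic_intro.
- by rewrite cE; nra.
- by split; [exact: interval_is_interval|exact: interval_closed].
- apply: (@lipschitz_within _ _ C%:R) => // s t.
  rewrite /= !in_itv /= => /andP[s0 _] /andP[t0 _].
  have [st|/ltW st] := leP s t; first by rewrite distrC ger0_norm ?subr_ge0 ?lip.
  by rewrite metric_sym ger0_norm ?subr_ge0 ?lip.
- move=> s t; rewrite /= !in_itv /= => /andP[s0 _] _ st.
  by have := lip s t s0 st; nra.
- move=> s t; rewrite /= !in_itv /= => /andP[s0 _] /andP[_ tk] st.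
  have t0 := le_trans s0 st.
  have [is_ si] := truncn_bounds s0; have [jt tj] := truncn_bounds t0.
  have := le_truncn st.
  move: (Num.truncn s) (Num.truncn t) is_ si jt tj => i j is_ si jt tj ij.
  have jk : (j <= k)%N by rewrite -(ler_nat R); lra.
  have := yL i j ij jk; rewrite -(ler_nat R) !natrD natrM.
  have gi : g i%:R = y i by rewrite gN /y' (minn_idPl (leq_trans ij jk)).
  have gj : g j%:R = y j by rewrite gN /y' (minn_idPl jk).
  have h1 := lip i%:R s (ler0n _ _) is_; have h2 := lip j%:R t (ler0n _ _) jt.
  rewrite gi in h1; rewrite gj in h2.
  have h3 := metric_triangle (y i) (g s) (y j).
  have h4 := metric_triangle (g s) (g t) (y j); rewrite (metric_sym (g t)) in h4.
  have h5 := ndist_lt (y i) (y j); have h6 := mdist_ge0 (g s) (g t).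
  move: (mdist (g s) (g t)) (mdist (y i) (g s)) (mdist (y j) (g t)) (ndist (y i) (y j))%:R
    (mdist (y i) (y j)) (mdist (g s) (y j)) h1 h2 h3 h4 h5 h6 => d d1 d2 e e' d3 h1 h2 h3 h4 h5 h6 h7.
  have d1C : d1 <= C%:R by nra.
  have d2C : d2 <= C%:R by nra.
  have eC : C%:R * e <= C%:R * (d + 2 * C%:R + 1) by apply: ler_wpM2l => //; lra.
  rewrite cE; nra.
- move=> s t; rewrite /= !in_itv /= => /andP[s0 _] _ st.
  apply: le_trans (_ : (C%:R * (t - s))%:E <= _)%E.
    apply: arc_length_lipschitz => u v su uv vt; apply: lip => //; exact: le_trans su.
  by rewrite lee_fin; nra.
Qed.

(* Sampling times with unit steps on [[a, b]], the last step being shorter. *)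
Definition clip (a b : R) (i : nat) : R := Num.min (a + i%:R) b.

Lemma clip_cases a b i : (clip a b i = a + i%:R /\ a + i%:R <= b) \/
  (clip a b i = b /\ b <= a + i%:R).
Proof. by rewrite /clip; case: (leP (a + i%:R) b) => [|/ltW]; [left|right]. Qed.

Lemma clip0 a b : a <= b -> clip a b 0 = a.
Proof. by move=> ab; rewrite /clip addr0; apply/min_idPl. Qed.

Lemma clip_end a b i : b - a <= i%:R -> clip a b i = b.
Proof. by move=> ab; rewrite /clip; apply/min_idPr; lra. Qed.

Lemma clip_bounds a b i : a <= b -> a <= clip a b i <= b.
Proof. by move=> ab; have := ler0n R i; case: (clip_cases a b i) => -[-> h]; lra. Qed.

Lemma clip_diff a b i j : (i <= j)%N -> a <= b ->
  0 <= clip a b j - clip a b i <= j%:R - i%:R.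
Proof.
rewrite -(ler_nat R) => ij ab.
by case: (clip_cases a b i) => -[-> h]; case: (clip_cases a b j) => -[-> h']; lra.
Qed.

Lemma clip_diff_ge a b i j : (i <= j)%N -> a <= b -> (j <= nceil (b - a))%N ->
  j%:R - i%:R <= clip a b j - clip a b i + 1.
Proof.
rewrite -!(ler_nat R) => ij ab jn.
have := @nceil_lt (b - a); rewrite subr_ge0 => /(_ ab).
by case: (clip_cases a b i) => -[-> h]; case: (clip_cases a b j) => -[-> h']; lra.
Qed.

Lemma sample_pair (lam kap a b : R) g A i j : 1 <= lam -> 0 <= kap ->
  lam + kap <= A%:R -> lam * kap + 1 <= A%:R -> a <= b -> (i <= j)%N ->
  lam^-1 * (clip a b j - clip a b i) - kap <=
    mdist (g (clip a b i)) (g (clip a b j)) <= lam * (clip a b j - clip a b i) + kap ->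
  ((j <= i.+1)%N -> (ndist (g (clip a b i)) (g (clip a b j)) <= A)%N) /\
  ((j <= nceil (b - a))%N ->
     (j <= i + (A * ndist (g (clip a b i)) (g (clip a b j)) + A))%N).
Proof.
move=> l1 k0 A1 A2 ab ij /andP[low up]; split=> jn.
  rewrite ndist_le; apply: le_trans up _.
  have /andP[h1 h2] := clip_diff ij ab.
  have : clip a b j - clip a b i <= 1.
    by apply: le_trans h2 _; move: jn; rewrite -(ler_nat R) -natr1; lra.
  by nra.
rewrite -(ler_nat R) !natrD natrM; move: low.
have := clip_diff_ge ij ab jn.
have := mdist_le_ndist (g (clip a b i)) (g (clip a b j)).
have := mdist_ge0 (g (clip a b i)) (g (clip a b j)).
move: (clip a b j - clip a b i) (mdist _ _) (ndist _ _)%:R => u d e d0 de uj.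
rewrite lerBlDr mulrC ler_pdivrMr; last lra.
by nra.
Qed.

Lemma sample_dqg (lam kap a b : R) g A : qg_pair lam kap -> lam + kap <= A%:R ->
  lam * kap + 1 <= A%:R -> a <= b -> quasi_geodesic lam kap `[a, b]%classic g ->
  dqg ndist A (nceil (b - a)) (g \o clip a b).
Proof.
move=> [l1 k0] A1 A2 ab [_ qg _ _].
have inI i : `[a, b]%classic (clip a b i) by rewrite /= in_itv /= clip_bounds.
have key i j (ij : (i <= j)%N) : lam^-1 * (clip a b j - clip a b i) - kap <=
    mdist (g (clip a b i)) (g (clip a b j)) <= lam * (clip a b j - clip a b i) + kap.
  have /andP[h _] := clip_diff ij ab.
  by have := qg _ _ (inI i) (inI j); rewrite distrC ger0_norm.
split=> [i _|i j ij jn] /=.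
  by have [h _] := sample_pair l1 k0 A1 A2 ab (leqnSn i) (key _ _ (leqnSn i)); apply: h.
by have [_ h] := sample_pair l1 k0 A1 A2 ab ij (key _ _ ij); apply: h.
Qed.

(** The infimum need not be attained; the extra [1] pays for that. *)
Lemma closed_nbhdP (r : R) (Y : set X) x : closed_nbhd r Y x ->
  exists2 y, Y y & mdist x y < r + 1.
Proof.
rewrite /closed_nbhd /= => le.
have : (ereal_inf [set (mdist x y)%:E | y in Y] < (r + 1)%:E)%E.
  by apply: le_lt_trans le _; rewrite lte_fin ltrDl.
by move=> /ereal_inf_lt[_ [y Yy <-]]; rewrite lte_fin; exists y.
Qed.

Lemma closed_nbhdI (r : R) (Y : set X) x y : Y y -> mdist x y <= r ->
  closed_nbhd r Y x.
Proof.
move=> Yy d; rewrite /closed_nbhd /=; apply: (@le_trans _ _ (mdist x y)%:E).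
  by apply: ereal_inf_lbound; exists y.
by rewrite lee_fin.
Qed.

Lemma nat_above (r : R) : exists A : nat, r <= A%:R.
Proof. by exists (Num.truncn r).+1; rewrite ltW ?truncnS_gt. Qed.

(** The [1] is the slack of [closed_nbhdP], and [lam + kap] pays for rounding down to a sampling
    time. [C.+1] ensures the positivity that [interpolate] requires. *)
Definition sample_gauge (lam kap : R) (M : R -> R -> R) C : nat :=
  nceil (M (interp_cst C.+1) (interp_cst C.+1) + 1 + lam + kap).

Lemma interp_pair C : qg_pair (interp_cst C) (interp_cst C).
Proof. by have := ler0n R C; rewrite /qg_pair /interp_cst => C0; split; nra. Qed.

Lemma local_qg_sample (lam kap s t : R) M p A L : geodesic_space X ->
  qg_pair lam kap -> morse_gauge M -> lam + kap <= A%:R ->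
  lam * kap + 1 <= A%:R -> s <= t ->
  (forall u v, s <= u -> u <= v -> v <= t -> v - u <= L%:R + 1 ->
    quasi_geodesic lam kap `[u, v]%classic p /\ morse M `[u, v]%classic p) ->
  local_qg ndist A (sample_gauge lam kap M) L (nceil (t - s)) (p \o clip s t).
Proof.
move=> geo [l1 k0] gM A1 A2 st loc.
(* With [L.+1] in place of [L], single steps are covered even if [L = 0]. *)
have qg i j (ij : (i <= j)%N) (jL : (j <= i + L.+1)%N) :
    quasi_geodesic lam kap `[clip s t i, clip s t j]%classic p /\
    morse M `[clip s t i, clip s t j]%classic p.
  have /andP[a1 a2] := clip_bounds i st; have /andP[b1 b2] := clip_bounds j st.
  have /andP[d1 d2] := clip_diff ij st; apply: loc => //; first by lra.
  apply: le_trans d2 _.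
  by rewrite lerBlDr natr1 -natrD ler_nat addnC.
have pair i j : (i <= j)%N -> (j <= i + L.+1)%N ->
    lam^-1 * (clip s t j - clip s t i) - kap <=
    mdist (p (clip s t i)) (p (clip s t j)) <= lam * (clip s t j - clip s t i) + kap.
  move=> ij jL; have [[_ h _ _] _] := qg _ _ ij jL.
  have /andP[d _] := clip_diff ij st; have dd := d; rewrite subr_ge0 in dd.
  by have := h (clip s t i) (clip s t j); rewrite /= !in_itv /= !lexx dd distrC ger0_norm //; apply.
split.
- move=> i _; have [|h _] := sample_pair l1 k0 A1 A2 st (leqnSn i) (pair _ _ (leqnSn i) _).
    by lia.
  exact: h.
- move=> i j ij jn jL; have [|_ h] := sample_pair l1 k0 A1 A2 st ij (pair _ _ ij _).
    by lia.
  exact: h.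
move=> C k y i j yQ ij jn jL y0 yk l lk.
have [g [gy gQ]] := interpolate geo (ltn0Sn C) (dqgW (leqnSn C) yQ).
have [[_ qgp _ _] mor] : quasi_geodesic lam kap `[clip s t i, clip s t j]%classic p /\
    morse M `[clip s t i, clip s t j]%classic p by apply: qg => //; lia.
have /andP[d d'] := clip_diff ij st; rewrite subr_ge0 in d.
have [_ [u /= ui <-] yu] : exists2 x,
    (p @` `[clip s t i, clip s t j]%classic) x &
    mdist (y l) x < M (interp_cst C.+1) (interp_cst C.+1) + 1.
  apply/closed_nbhdP/(mor _ _ (interp_pair _) (clip s t i) (clip s t j) _ _ d 0 k%:R g).
  - by rewrite /= in_itv /= lexx.
  - by rewrite /= in_itv /= lexx d.
  - by [].
  - by [].
  - by have := gy 0%N (leq0n _); rewrite y0.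
  - by have := gy k (leqnn _); rewrite yk.
  - by exists l%:R; rewrite ?gy //= in_itv /= ler0n ler_nat.
move: (ui); rewrite in_itv /= => /andP[iu uj].
have [f1 f2] := @truncn_bounds (u - clip s t i) ltac:(lra).
set f := Num.truncn _ in f1 f2.
have [fE fj] : clip s t (i + f) = clip s t i + f%:R /\ (i + f <= j)%N.
  have /andP[_ jt] := clip_bounds j st.
  case: (clip_cases s t i) => -[ci cit].
    split; last by rewrite -(ler_nat R) natrD; lra.
    by rewrite ci /clip natrD addrA; apply/min_idPl; lra.
  have f0 : f = 0%N by apply/eqP; rewrite -leqn0 -(ler_nat R); lra.
  by rewrite f0 addn0 addr0.
exists (i + f)%N; split=> //; first exact: leq_addr.
rewrite ndist_le; apply: le_trans
  (_ : M (interp_cst C.+1) (interp_cst C.+1) + 1 + lam + kap <= _); last first.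
  by apply/nceil_ge; have := gM _ _ (interp_pair C.+1); lra.
have := metric_triangle (y l) (p u) (p (clip s t (i + f))).
have : mdist (p u) (p (clip s t (i + f))) <= lam + kap.
  have fi : clip s t (i + f) \in `[clip s t i, clip s t j].
    by have f0 := ler0n R f; rewrite in_itv /= fE; lra.
  have /andP[_ h] := qgp _ _ ui fi; apply: le_trans h _.
  rewrite fE ger0_norm; last by lra.
  by rewrite lerD2r -[leRHS]mulr1 ler_wpM2l; lra.
rewrite /=; lra.
Qed.

(** Length adds up over unit pieces, each controlled by the local improvement clause; this yields
    the global one. *)
Lemma arc_length_local (lam kap s t : R) (p : R -> X) (L : nat) : qg_pair lam kap -> s <= t ->
  (forall u v, s <= u -> u <= v -> v <= t -> v - u <= L%:R + 1 ->
    quasi_geodesic lam kap `[u, v]%classic p) ->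
  (arc_length p s t <=
    ((improve_k1 lam kap * (lam + kap) + improve_k2 lam kap) * (t - s + 2))%:E)%E.
Proof.
move=> [l1 k0] st loc; set w := _ + improve_k2 _ _.
have k10 : 0 <= improve_k1 lam kap by rewrite /improve_k1; nra.
have w0 : 0 <= w by rewrite /w /improve_k2; nra.
have short u v : s <= u -> u <= v -> v <= t -> v - u <= 1 ->
    (arc_length p u v <= w%:E)%E.
  move=> su uv vt vu; have L0 := ler0n R L.
  have [_ qg _ arc] := loc u v su uv vt ltac:(lra).
  have uI : `[u, v]%classic u by rewrite /= in_itv /= lexx.
  have vI : `[u, v]%classic v by rewrite /= in_itv /= uv lexx.
  apply: le_trans (arc _ _ uI vI uv) _; rewrite lee_fin lerD2r ler_wpM2l //.
  have /andP[_ h] := qg _ _ uI vI; apply: le_trans h _.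
  by rewrite distrC ger0_norm; nra.
have long n v : s <= v -> v <= t -> v - s <= n%:R -> (arc_length p s v <= (w * n.+1%:R)%:E)%E.
  elim: n v => [|n IH] v sv vt vn.
    by rewrite mulr1; apply: short => //; lra.
  have [vs|vs] := leP (v - s) 1.
    apply: le_trans (short s v (lexx _) sv vt vs) _; rewrite lee_fin ler_peMr //.
    by rewrite ler1n.
  rewrite -natr1 mulrDr mulr1.
  have v1 : s <= v - 1 by lra.
  have v2 : v - 1 <= v by lra.
  apply: (arc_length_cat v1 v2); last by apply: short => //; lra.
  by apply: IH => //; [lra|move: vn; rewrite -natr1; lra].
apply: le_trans (long (nceil (t - s)) t st (lexx _) _) _.
  by apply: nceil_ge; lra.
rewrite lee_fin ler_wpM2l // -natr1.
by have := @nceil_lt (t - s) ltac:(lra); lra.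
Qed.

Lemma combing_sample (lam kap : R) T (c : X -> X -> R -> X) A :
  qg_pair lam kap -> qg_combing lam kap T c -> bounded_combing kap c ->
  lam + kap <= A%:R -> lam * kap + 1 <= A%:R ->
  exists (T' : X -> X -> nat) (c' : X -> X -> nat -> X),
  [/\ forall z w, dqg ndist A (T' z w) (c' z w), forall z w, c' z w 0%N = z,
      forall z w t, (T' z w <= t)%N -> c' z w t = w &
      forall z w w' t, (ndist (c' z w t) (c' z w' t) <= A * ndist w w' + A)%N].
Proof.
move=> [l1 k0] cQ cB A1 A2.
exists (fun z w => nceil (T z w - 0)), (fun z w => c z w \o clip 0 (T z w)).
(* Lines are constant past their end, so clipped and integer times agree and boundedness applies at
   equal times. *)
have c_clip z w i : c z w (clip 0 (T z w) i) = c z w i%:R.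
  have [T0 _ _ ce] := cQ z w.
  by case: (clip_cases 0 (T z w) i) => -[-> h]; rewrite ?add0r // !ce // -[leRHS]add0r.
split=> [z w|z w|z w t Tt|z w w' t] /=; rewrite ?c_clip.
- by have [T0 q _ _] := cQ z w; apply: (@sample_dqg lam kap).
- by have [_ _ h _] := cQ z w; apply: h.
- have [T0 _ _ h] := cQ z w; apply: h.
  by rewrite nceil_le ?subr0 // in Tt.
rewrite ndist_le natrD natrM; apply: le_trans (cB _ _ _ _) _.
have := mdist_le_ndist w w'; have := mdist_ge0 w w'.
have kA : kap <= A%:R by lra.
by move=> d0 de; rewrite lerD // ler_pM.
Qed.

End MetricSpaces.

(** * Transfer of the discrete theorem to the geodesic space *)

Theorem theorem1p3 (R : realType) (X : metricType R) :
  geodesic_space X -> has_bounded_qg_combing X -> weak_MLTG X.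
Proof.
move=> geo [lam0 [kap0 [pr0 [T [c [cQ cB]]]]]] lam kap Q q M pr prQ gM.
(* [A] serves the path and the combing, [B] the test quasi-geodesics; the discrete constant
   [3 * A + B] dominates both. *)
have [A AE] := nat_above (lam + kap + lam * kap + 1 + lam0 + kap0 + lam0 * kap0 + 1).
have [B BE] := nat_above (Q + q + Q * q + 1).
have [l1 k0] := pr; have [l01 k00] := pr0; have [Q1 q0] := prQ.
have lk : 0 <= lam * kap by rewrite mulr_ge0 //; lra.
have lk0 : 0 <= lam0 * kap0 by rewrite mulr_ge0 //; lra.
have Qq : 0 <= Q * q by rewrite mulr_ge0 //; lra.
have [T' [c' [cQ' c0' cT' cB']]] := @combing_sample _ _ lam0 kap0 T c A pr0 cQ cB ltac:(lra) ltac:(lra).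
have A0 : (0 < A)%N by rewrite -(ltr_nat R); lra.
have [L [W [mu core]]] := local_to_global (@ndistxx R X) (@ndistC R X)
  (@ndist_triangle R X) (ndist_geodesic geo) (sample_gauge lam kap M) A0 (leq_addr B (3 * A)).
have {}core := core T' c' cQ' c0' cT' cB'.
pose w := improve_k1 lam kap * (lam + kap) + improve_k2 lam kap.
have w0 : 0 <= w.
  have k10 : 0 <= improve_k1 lam kap by rewrite /improve_k1; nra.
  by rewrite /w /improve_k2; nra.
have W0 := ler0n R W.
pose C : R := 1 + 2 * W%:R + 2 * w.
(* [L%:R + 1] is the window of [local_qg_sample]; [Q + q] pays for moving a point of [eta] to a
   sampling time. *)
exists (L%:R + 1), C, C, (mu%:R + Q + q); split.
- by rewrite ltr_wpDl // ler0n.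
- by rewrite /C; split; lra.
- by have := ler0n R mu; lra.
move=> I p [[Ii Ic] pc] ploc.
have loc s t : I s -> I t -> forall u v, s <= u -> u <= v -> v <= t -> v - u <= L%:R + 1 ->
    quasi_geodesic lam kap `[u, v]%classic p /\ morse M `[u, v]%classic p.
  move=> Is It u v su uv vt vu; apply: ploc => //.
  - by apply: (Ii s t) => //; rewrite su (le_trans uv).
  - by apply: (Ii s t) => //; rewrite vt (le_trans su).
  - by rewrite distrC ger0_norm ?subr_ge0.
have PL s t : I s -> I t -> s <= t ->
    local_qg ndist A (sample_gauge lam kap M) L (nceil (t - s)) (p \o clip s t).
  by move=> Is It st; apply: local_qg_sample (loc s t Is It) => //; lra.
have Pt s t : s <= t -> (p \o clip s t) (nceil (t - s)) = p t.
  by move=> st; rewrite /= clip_end // nceil_ge // subr_ge0.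
split.
- apply: quasi_geodesic_intro => //; first by rewrite /C; lra.
  + move=> s t Is It st; have [PW _] := core _ _ (PL s t Is It st).
    have := dqg_step (@ndistxx R X) (@ndist_triangle R X) PW (leq0n _) (leqnn _).
    rewrite Pt // /= clip0 // subn0 ndist_le natrM => h; apply: le_trans h _.
    have := @nceil_lt R (t - s) ltac:(lra); move: (nceil _)%:R => n nt.
    have : W%:R * n <= W%:R * (t - s + 1) by rewrite ler_wpM2l // ltW.
    by rewrite /C; nra.
  + move=> s t Is It st; have [[_ PW] _] := core _ _ (PL s t Is It st).
    have := PW _ _ (leq0n _) (leqnn _); rewrite Pt // /= clip0 // add0n.
    rewrite -(ler_nat R) natrD natrM.
    have := @nceil_ge R (t - s) ltac:(lra); have := ndist_lt (p s) (p t).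
    have := mdist_ge0 (p s) (p t); move: (ndist _ _)%:R (mdist _ _) (nceil _)%:R => e d n d0 de nt h.
    have : W%:R * e <= W%:R * (d + 1) by rewrite ler_wpM2l // ltW.
    by rewrite /C; nra.
  + move=> s t Is It st.
    have h := arc_length_local pr st (fun u v su uv vt vu => proj1 (loc s t Is It u v su uv vt vu)).
    apply: le_trans h _; rewrite lee_fin -/w /C; nra.
move=> s t Is It st a b eta ab etaQ ea eb x [tau].
rewrite /= in_itv /= => /andP[atau taub] <-.
have [_ near] := core _ _ (PL s t Is It st).
have y0 : (eta \o clip a b) 0%N = (p \o clip s t) 0%N by rewrite /= !clip0.
have yk : (eta \o clip a b) (nceil (b - a)) = (p \o clip s t) (nceil (t - s)).
  by rewrite Pt //= clip_end // nceil_ge // subr_ge0.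
have yQ : dqg ndist (3 * A + B) (nceil (b - a)) (eta \o clip a b).
  have BA : B%:R <= (3 * A + B)%:R :> R by rewrite ler_nat leq_addl.
  by apply: (sample_dqg prQ _ _ ab etaQ); apply: le_trans BA; lra.
have [f1 f2] := @truncn_bounds R (tau - a) ltac:(lra).
set l := Num.truncn _ in f1 f2.
have lb : (l <= nceil (b - a))%N.
  by rewrite -(ler_nat R); have := @nceil_ge R (b - a) ltac:(lra); lra.
have [e [_ en d]] := near _ _ _ _ (leq0n _) (leqnn _) yQ y0 yk l lb.
have lE : clip a b l = a + l%:R by apply/min_idPl; lra.
apply: (@closed_nbhdI _ _ _ _ _ (p (clip s t e))).
  by exists (clip s t e) => //; rewrite /= in_itv /= clip_bounds.
have [_ qg _ _] := etaQ.
have l0 := ler0n R l.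
have /andP[_ h] : Q^-1 * `|tau - clip a b l| - q <= mdist (eta tau) (eta (clip a b l)) <=
    Q * `|tau - clip a b l| + q.
  by apply: qg; rewrite /= in_itv /= ?atau ?taub // clip_bounds.
move: d; rewrite ndist_le /= metric_sym.
have := metric_triangle (eta tau) (eta (clip a b l)) (p (clip s t e)).
have : Q * `|tau - clip a b l| <= Q by rewrite lE ger0_norm; [rewrite ger_pMr; lra|lra].
lra.
Qed.
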